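(* Let $\mathcal{G}$ be a finite connected graph with positive conductances and non-negative killing rates not all zero, with a chosen spanning tree $T$ and chosen orientations $e_1,\dots,e_r$ of the edges not in $T$; let $\mu$ be the loop measure and, for $\alpha>0$, let $\mathcal{L}_\alpha$ be the Poisson point process of loops with intensity $\alpha\mu$. Denote by $\mathcal{L}_\alpha^{(>1)}$ the subset of $\mathcal{L}_\alpha$ formed by all loops of degree greater than $1$. Then, as $(m_{i,j})_{1\le i<j\le r}$ varies over all families of integers, the numbers $|\{l\in\mathcal{L}^{(>1)}_\alpha:\ \check N_{i,j}(l)=m_{i,j},\ 1\le i<j\le r\}|$ are independent Poisson random variables with expectations $$\alpha\,\mu(\{l:\ h_1(l)=0,\ \check N_{i,j}(l)=m_{i,j},\ 1\le i<j\le r\})=-\alpha\int_{[0,1]^{r(r-1)/2}}F(u)\prod_{i<j}e^{-2\pi\sqrt{-1}\,m_{i,j}u_{i,j}}\,du_{i,j},$$ where $$F(u)=\lim_{p\uparrow\infty}\frac1{p^r}\log\bigl(\det(I-P^{A,U_{h(u,p)}})\bigr),$$ the limit being taken along (odd) primes $p$.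
   Context: Graph and loops: $\mathcal{G}$ is a finite connected non-oriented graph with vertex set $X$ and edge set $E$, with no loop edges and no multiple edges; $r=|E|-|X|+1$. An oriented edge $e$ has extremities $(e^-,e^+)$ and opposite $-e$. A based loop is a path $(x_0,x_1,\dots,x_{n-1},x_0)$, $n\ge1$, along edges; a loop is an equivalence class of based loops under cyclic shift. $\mathrm{mult}(l)$ is the largest integer $m$ such that a based loop representing $l$ is the concatenation of $m$ identical based loops. Degree and homology: with $T$ and the $e_i$ fixed, the fundamental group is identified with the free group $\Gamma$ on $\gamma_1,\dots,\gamma_r$: a based loop successively crossing the oriented non-tree edges $\varepsilon_1e_{i_1},\dots,\varepsilon_ke_{i_k}$ ($\varepsilon_a=\pm1$) has homotopy class $\gamma_{i_1}^{\varepsilon_1}\cdots\gamma_{i_k}^{\varepsilon_k}$; a loop determines a conjugacy class of $\Gamma$. With $\Gamma^{(1)}=\Gamma$, $\Gamma^{(n+1)}=[\Gamma^{(n)},\Gamma]$, the degree of a loop is the largest $n$ such that its conjugacy class lies in $\Gamma^{(n)}$ ($\infty$ if the loop is homotopic to a point), and $h_1(l)$ is the image of $l$ in $\Gamma^{(1)}/\Gamma^{(2)}\cong\mathbb{Z}^r$. Degree $>1$ is equivalent to $h_1(l)=0$, and to $\check N_i(l)=0$ for all $i$, where $\check N_i(l)$ is the number of traversals of $e_i$ minus the number of traversals of $-e_i$ by $l$. Crossing numbers: for a based loop $l_\bullet$, $N_{e,f}(l_\bullet)$ is the number of pairs of times $s<t$ such that $l_\bullet$ crosses the oriented edge $e$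 at time $s$ and $f$ at time $t$; $\check N_{i,j}=N_{e_i,e_j}+N_{-e_i,-e_j}-N_{e_i,-e_j}-N_{-e_i,e_j}$. If $h_1(l)=0$ and $i\neq j$, $\check N_{i,j}(l_\bullet)$ does not depend on the based loop $l_\bullet$ representing $l$, and is denoted $\check N_{i,j}(l)$. Markov chain and loop measure: conductances $C_{x,y}=C_{y,x}>0$ on edges ($C_{x,y}=0$ if $\{x,y\}\notin E$), killing rates $\kappa_x\ge0$, not all zero, $\lambda_x=\kappa_x+\sum_yC_{x,y}$, $P^x_y=C_{x,y}/\lambda_x$. The loop measure is $\mu(l)=\frac{1}{\mathrm{mult}(l)}\prod_{\text{edges }e\text{ of }l}P^{e^-}_{e^+}$, the product being over all edge traversals of $l$; its total mass is $-\log\det(I-P)$. Nilpotent group: for an odd prime $p$ and $\mathbb{Z}_p=\mathbb{Z}/p\mathbb{Z}$, let $G=\{(a,c):a\in\mathbb{Z}_p^r,\ c\in[\mathbb{Z}_p^r]^{\wedge2}\}$, where $[\mathbb{Z}_p^r]^{\wedge2}$ is identified with the skew-symmetric $r\times r$ matrices over $\mathbb{Z}_p$, with product $(a,c)\cdot(a',c')=(a+a',\,c+c'+\frac12(a\otimes a'-a'\otimes a))$. Representation: for a skew-symmetric $r\times r$ matrix $h$ over $\mathbb{Z}_p$, $U_h$ is the unitary representation of $G$ on the $p^r$-dimensional space of complex functions on $\mathbb{Z}_p^r$ given by $$U_h[(a,c)]\psi(x)=e^{\frac{2\pi\sqrt{-1}}{p}(\langle c,h\rangle+\langle a,x\rangle)}\,\psi(x-h\cdot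 a),$$ with $\langle c,h\rangle=\sum_{1\le i,j\le r}h_{i,j}c_{i,j}$, $(h\cdot a)_i=\sum_{1\le j\le r}h_{i,j}a_j$, $\langle a,x\rangle=\sum_{1\le i\le r}a_ix_i$. Connection: $A$ assigns to $e_i$ the element $(v_i,0)\in G$, where $v_i$ is the $i$-th canonical basis vector, to $-e_i$ its inverse $(-v_i,0)$, and to every oriented edge of $T$ the neutral element. For a unitary representation $\pi$ of $G$, $P^{A,\pi}$ is the matrix indexed by $X\times\{1,\dots,\dim\pi\}$ with entries $[P^{A,\pi}]^{x,k}_{y,k'}=P^x_y\,[\pi(A[(x,y)])]^k_{k'}$. For $u=(u_{i,j})_{1\le i<j\le r}$ with coefficients in $[0,1)$, $h(u,p)$ is the skew-symmetric matrix over $\mathbb{Z}_p$ whose entries for $i<j$ are the classes mod $p$ of the integral parts of $p\,u_{i,j}$.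
   Formalization: The exponential in the integral is e^{-2πi·2m_{ij}u_{ij}} instead of e^{-2πi·m_{ij}u_{ij}}: with the given U_h a loop with h_1=0 has phase 2Σh_{ij}Ň_{ij}, so F has only even frequencies and the printed formula fails, e.g. for r≥2, m_{12}=1. *)

(* Defs.v *)
From HB Require Import structures.
From mathcomp Require Import all_boot all_order all_algebra.
From mathcomp Require Import generic_quotient.
From mathcomp Require Import all_classical all_reals all_analysis.
From mathcomp Require Import measurable_realfun complex.

Set Implicit Arguments.
Unset Strict Implicit.
Unset Printing Implicit Defensive.

Import Order.TTheory GRing.Theory Num.Theory.
Import numFieldNormedType.Exports.

Local Open Scope classical_set_scope.
Local Open Scope ring_scope.
Local Open Scope quotient_scope.

Section Graph.
Variable X : finType.
Implicit Types E T : rel X.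

Definition simple_graph E := symmetric E /\ irreflexive E.

Definition connected_graph E := forall x y : X, connect E x y.

Definition edge_set E : {set {set X}} :=
  [set [set xy.1; xy.2]%SET | xy : X * X in [pred xy | E xy.1 xy.2]]%SET.

(* For a symmetric relation, the sequences of size 1 and 2 are cycles in the
   sense of [ucycle] as soon as they consist of adjacent vertices; the genuine
   cycles of a simple graph have at least 3 vertices. *)
Definition acyclic T := forall c : seq X, ucycle T c -> (size c <= 2)%N.

Definition spanning_tree E T :=
  [/\ symmetric T, subrel T E, connected_graph T & acyclic T].

Definition opp_edge (a : X * X) : X * X := (a.2, a.1).

Definition cotree_orientation E T (r : nat) (e : 'I_r -> X * X) :=
  [/\ forall i, E (e i).1 (e i).2 && ~~ T (e i).1 (e i).2,
      forall i j, e i = e j -> i = j,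
      forall i j, e i <> opp_edge (e j) &
      forall x y, E x y -> ~~ T x y ->
        exists i, e i = (x, y) \/ e i = (y, x)].

End Graph.

Section Loops.
Variables (X : finType) (E : rel X).

(* [:: x_0; ...; x_(n-1)] stands for the based loop (x_0, ..., x_(n-1), x_0). *)
Definition is_based_loop (s : seq X) := (s != [::]) && cycle E s.

Definition based_loop := {s : seq X | is_based_loop s}.

Definition shift_equiv (s t : based_loop) :=
  [exists k : 'I_(size (val s)).+1, val t == rot k (val s)].

Lemma shift_equivP (s t : based_loop) :
  reflect (exists k, val t = rot k (val s)) (shift_equiv s t).
Proof.
apply: (iffP existsP) => [[k /eqP ->]|[k ts]]; first by exists k.
have [ks|ks] := leqP k (size (val s)).
  by exists (Ordinal (ks : (k < (size (val s)).+1)%N)); apply/eqP.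
by exists ord0; apply/eqP; rewrite ts rot0 rot_oversize// ltnW.
Qed.

Lemma shift_equiv_refl : reflexive shift_equiv.
Proof. by move=> s; apply/shift_equivP; exists 0%N; rewrite rot0. Qed.

Lemma shift_equiv_imp (s t : based_loop) : shift_equiv s t -> shift_equiv t s.
Proof.
move=> /shift_equivP [k ts]; apply/shift_equivP.
by exists (size (val t) - k)%N; rewrite ts -/(rotr k _) rotK.
Qed.

Lemma shift_equiv_sym : symmetric shift_equiv.
Proof. by move=> s t; apply/idP/idP; exact: shift_equiv_imp. Qed.

Lemma shift_equiv_trans : transitive shift_equiv.
Proof.
move=> t s u /existsP [k /eqP ts] /existsP [k' /eqP ut]; apply/shift_equivP.
move: (nat_of_ord k) (ltn_ord k) (nat_of_ord k') (ltn_ord k') ts ut.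
move=> {k k'} k + k' + ts; rewrite !ltnS ts size_rot => ks k's ->.
by rewrite rot_add_mod//; eexists.
Qed.

Definition shift_equivalence :=
  EquivRel shift_equiv shift_equiv_refl shift_equiv_sym shift_equiv_trans.

Definition loop := {eq_quot shift_equivalence}.

HB.instance Definition _ := Choice.on loop.

Definition based_at (l : loop) : seq X := val (repr l).

End Loops.

Section LoopFunctionals.
Variable X : finType.
Implicit Types s : seq X.

Definition steps s : seq (X * X) := zip s (rot 1 s).

(* If [s] is the concatenation of [m] copies of [t], then [t] is the prefix of
   [s] of length [size s %/ m], and it is a based loop when [s] is one. *)
Definition multiplicity s : nat :=
  \max_(m < (size s).+1 | s == flatten (nseq m (take (size s %/ m) s))) m.

Definition crossings (f g : X * X) s : nat :=
  let st := in_tuple (steps s) in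
  #|[set ab : 'I_(size (steps s)) * 'I_(size (steps s)) |
      [&& (ab.1 < ab.2)%N, tnth st ab.1 == f & tnth st ab.2 == g]]%SET|.

Definition signed_crossings (r : nat) (e : 'I_r -> X * X) (i j : 'I_r) s : int :=
  (crossings (e i) (e j) s)%:Z
  + (crossings (opp_edge (e i)) (opp_edge (e j)) s)%:Z
  - (crossings (e i) (opp_edge (e j)) s)%:Z
  - (crossings (opp_edge (e i)) (e j) s)%:Z.

(* [Some (i, true)] on e_i, [Some (i, false)] on -e_i, [None] otherwise. *)
Definition letter (r : nat) (e : 'I_r -> X * X) (a : X * X) :
    option ('I_r * bool) :=
  if [pick i | e i == a] is Some i then Some (i, true)
  else if [pick i | e i == opp_edge a] is Some i then Some (i, false)
  else None.

End LoopFunctionals.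

Section FreeGroup.
Variable r : nat.

(* Elements of the free group on r generators are represented by words, up to
   [free_eq]; (i, true) stands for gamma_i and (i, false) for its inverse. *)
Definition word := seq ('I_r * bool).

Definition inv_letter (x : 'I_r * bool) := (x.1, ~~ x.2).
Definition inv_word (w : word) : word := rev (map inv_letter w).

Inductive free_eq : word -> word -> Prop :=
| free_eq_cancel u v x : free_eq (u ++ x :: inv_letter x :: v) (u ++ v)
| free_eq_refl w : free_eq w w
| free_eq_sym w w' : free_eq w w' -> free_eq w' w
| free_eq_trans w w' w'' : free_eq w w' -> free_eq w' w'' -> free_eq w w''.

Inductive generated (S : set word) : word -> Prop :=
| generated_in w : S w -> generated S w
| generated_1 : generated S [::]
| generated_mul w w' : generated S w -> generated S w' -> generated S (w ++ w')
| generated_inv w : generated S w -> generated S (inv_word w)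
| generated_eq w w' : free_eq w w' -> generated S w -> generated S w'.

Definition commutator (a b : word) : word :=
  inv_word a ++ inv_word b ++ a ++ b.

(* [lower_central n] is Gamma^(n+1): the index is shifted by one. *)
Fixpoint lower_central (n : nat) : set word :=
  if n is n'.+1 then
    generated [set w | exists a b, lower_central n' a /\ w = commutator a b]
  else setT.

Definition conjugacy_class (w : word) : set word :=
  [set w' | exists v, free_eq w' (v ++ w ++ inv_word v)].

End FreeGroup.

Section Homotopy.
Variables (R : realType) (X : finType) (E : rel X) (r : nat).
Variable e : 'I_r -> X * X.

Definition homotopy_word (s : seq X) : word r := pmap (letter e) (steps s).

(* The supremum of the n with the conjugacy class of l inside Gamma^(n): the
   largest such n if there is one, and +oo otherwise. *)
Definition degree (l : loop E) : \bar R :=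
  ereal_sup [set n.+1%:R%:E | n in
    [set n | conjugacy_class (homotopy_word (based_at l)) `<=`
             lower_central n]].

(* The image in Gamma^(1) / Gamma^(2), identified with Z^r by sending the class
   of gamma_i to the i-th basis vector. *)
Definition h1 (l : loop E) : 'rV[int]_r :=
  \sum_(x <- homotopy_word (based_at l))
     (if x.2 then 1 else -1) *: delta_mx 0 x.1.

(* Evaluated on a chosen based representative; meaningful when i <> j and
   h1 l = 0, since it is then independent of the representative. *)
Definition Ncheck (i j : 'I_r) (l : loop E) : int :=
  signed_crossings e i j (based_at l).

End Homotopy.

Section LoopMeasure.
Variables (R : realType) (X : finType).

Definition conductances (E : rel X) (C : X -> X -> R) :=
  [/\ forall x y, C x y = C y x,
      forall x y, E x y -> 0 < C x y &
      forall x y, ~~ E x y -> C x y = 0].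

Definition killing (kappa : X -> R) :=
  (forall x, 0 <= kappa x) /\ (exists x, kappa x != 0).

Variables (C : X -> X -> R) (kappa : X -> R).

Definition lambda (x : X) : R := kappa x + \sum_y C x y.

Definition trans (x y : X) : R := C x y / lambda x.

Definition loop_weight (E : rel X) (l : loop E) : R :=
  (multiplicity (based_at l))%:R^-1
  * \prod_(a <- steps (based_at l)) trans a.1 a.2.

Definition loop_measure (E : rel X) (A : set (loop E)) : \bar R :=
  \esum_(l in A) (loop_weight l)%:E.

End LoopMeasure.

Section Poisson.
Variables (d : measure_display) (Omega : measurableType d) (R : realType).
Variable P : probability Omega R.

Definition independent_family (I : eqType) (Y : I -> Omega -> \bar R) :=
  forall s : seq I, uniq s ->
  forall B : I -> set (\bar R), (forall i, measurable (B i)) ->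
  P (\bigcap_(i in [set` s]) (Y i @^-1` B i)) =
  (\prod_(i <- s) P (Y i @^-1` B i))%E.

(* The Poisson law of parameter +oo is the Dirac mass at +oo. *)
Definition poisson_variable (Y : Omega -> \bar R) (rate : \bar R) :=
  measurable_fun [set: Omega] Y /\
  match rate with
  | EFin q => 0 <= q /\ forall B : set nat,
      P (Y @^-1` [set n%:R%:E | n in B]) = poisson_prob q 0%N B
  | EPInf => P (Y @^-1` [set +oo%E]) = 1%E
  | ENInf => False
  end.

(* A point configuration on S is given by the multiplicities of its points. *)
Definition num_points (S : choiceType) (L : Omega -> S -> nat) (A : set S)
    (w : Omega) : \bar R :=
  \esum_(x in A) (L w x)%:R%:E.

(* S is meant to be countable with its discrete sigma-algebra, so that all its
   subsets are measurable. *)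
Definition poisson_point_process (S : choiceType) (nu : set S -> \bar R)
    (L : Omega -> S -> nat) :=
  (forall A, poisson_variable (num_points L A) (nu A)) /\
  (forall (n : nat) (A : 'I_n -> set S), trivIset setT A ->
     independent_family (fun i => num_points L (A i))).

End Poisson.

Section Complex.
Variable R : realType.

Definition cis (t : R) : R[i] := (cos t +i* sin t)%C.

Definition cabs (z : R[i]) : R :=
  Num.sqrt (complex.Re z ^+ 2 + complex.Im z ^+ 2).

(* Principal determinations, with argument in ]-pi, pi]. *)
Definition carg (z : R[i]) : R :=
  let t := acos (complex.Re z / cabs z) in
  if 0 <= complex.Im z then t else - t.

Definition clog (z : R[i]) : R[i] := (ln (cabs z) +i* carg z)%C.

Variables (d : measure_display) (S : measurableType d).

Definition cintegrable (mu : {measure set S -> \bar R}) (D : set S)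
    (f : S -> R[i]) :=
  mu.-integrable D (EFin \o (fun x => complex.Re (f x))) /\
  mu.-integrable D (EFin \o (fun x => complex.Im (f x))).

Definition cintegral (mu : {measure set S -> \bar R}) (D : set S)
    (f : S -> R[i]) : R[i] :=
  (\int[mu]_(x in D) complex.Re (f x) +i* \int[mu]_(x in D) complex.Im (f x))%C.

End Complex.

Section LebesgueTuple.
Variable R : realType.

Definition tcons n (xt : R * n.-tuple R) : n.+1.-tuple R :=
  [tuple of xt.1 :: xt.2].

Definition tuncons n (t : n.+1.-tuple R) : R * n.-tuple R :=
  (thead t, [tuple of behead t]).

Lemma measurable_tcons n : measurable_fun [set: R * n.-tuple R] (@tcons n).
Proof.
by apply: measurable_cons; [exact: measurable_fst|exact: measurable_snd].
Qed.

Lemma measurable_tuncons n : measurable_fun [set: n.+1.-tuple R] (@tuncons n).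
Proof.
apply: measurable_fun_pair; first exact: measurable_tnth.
exact: measurable_behead.
Qed.

Lemma tconsK n : cancel (@tcons n) (@tuncons n).
Proof. by case=> x t; congr pair => //; exact/val_inj. Qed.

Section Step.
Variables (n : nat) (mu : {sigma_finite_measure set (n.-tuple R) -> \bar R}).

Definition lebesgue_cons : set (n.+1.-tuple R) -> \bar R :=
  pushforward (@lebesgue_measure R \x mu)%E (@tcons n).

Let preim_measurable (A : set (n.+1.-tuple R)) :
  measurable A -> measurable (@tcons n @^-1` A).
Proof.
by move=> mA; rewrite -[X in measurable X]setTI; exact: measurable_tcons.
Qed.

Let lebesgue_cons0 : lebesgue_cons set0 = 0%E.
Proof. by rewrite /lebesgue_cons /pushforward preimage_set0 measure0. Qed.

Let lebesgue_cons_ge0 A : (0 <= lebesgue_cons A)%E.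
Proof.
exact: (measure_ge0 (product_measure1 (@lebesgue_measure R) mu)).
Qed.

Let lebesgue_cons_sigma_additive : semi_sigma_additive lebesgue_cons.
Proof.
move=> F mF tF mUF; rewrite /lebesgue_cons /pushforward preimage_bigcup.
apply: measure_semi_sigma_additive.
- by move=> k; exact: preim_measurable.
- apply/trivIsetP => /= i j _ _ ij; rewrite -preimage_setI.
  by move/trivIsetP : tF => /(_ _ _ _ _ ij) ->//; rewrite preimage_set0.
- by rewrite -preimage_bigcup; exact: preim_measurable.
Qed.

HB.instance Definition _ := isMeasure.Build _ _ _ lebesgue_cons
  lebesgue_cons0 lebesgue_cons_ge0 lebesgue_cons_sigma_additive.

Let lebesgue_cons_sigma_finite : sigma_finite setT lebesgue_cons.
Proof.
have /sigma_finiteP[F [TF ndF Foo]] := sigma_finiteT (@lebesgue_measure R).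
have /sigma_finiteP[G [TG ndG Goo]] := sigma_finiteT mu.
exists (fun k => @tuncons n @^-1` (F k `*` G k)).
  rewrite predeqE => t; split => // _.
  have [k _ Fk] : (\bigcup_k F k) (thead t) by rewrite -TF.
  have [m _ Gm] : (\bigcup_k G k) [tuple of behead t] by rewrite -TG.
  exists (maxn k m) => //; split => /=.
  - by move: (thead t) Fk; exact/subsetPset/ndF/leq_maxl.
  - by move: Gm; exact/subsetPset/ndG/leq_maxr.
move=> k; have [mF Fk] := Foo k; have [mG Gk] := Goo k; split.
  rewrite -[X in measurable X]setTI.
  by apply: measurable_tuncons => //; exact: measurableX.
rewrite /lebesgue_cons /pushforward -comp_preimage.
rewrite (_ : (@tuncons n \o @tcons n) = id); last first.
  by apply/funext => x /=; rewrite tconsK.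
rewrite preimage_id product_measure1E//.
by rewrite lte_mul_pinfty// ge0_fin_numE.
Qed.

HB.instance Definition _ := Measure_isSigmaFinite.Build _ _ _ lebesgue_cons
  lebesgue_cons_sigma_finite.

End Step.

Fixpoint lebesgue_tuple (n : nat) :
    {sigma_finite_measure set (n.-tuple R) -> \bar R} :=
  if n is n'.+1 then lebesgue_cons (lebesgue_tuple n')
  else \d_([tuple] : 0.-tuple R).

Definition unit_cube (n : nat) : set (n.-tuple R) :=
  [set u | forall k, 0 <= tnth u k <= 1].

End LebesgueTuple.

Arguments unit_cube : clear implicits.

Section NilpotentGroup.
Variables (p r : nat).

Record nilgroup := Nilgroup {
  nil_a : 'cV['F_p]_r;
  nil_c : 'M['F_p]_r;
  nil_skew : nil_c^T = - nil_c }.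

Definition wedge (a b : 'cV['F_p]_r) : 'M['F_p]_r := a *m b^T - b *m a^T.

Lemma nil_mul_skew (g k : nilgroup) :
  let c := nil_c g + nil_c k + 2^-1 *: wedge (nil_a g) (nil_a k) in c^T = - c.
Proof.
have wedgeT a b : (wedge a b)^T = - wedge a b.
  by rewrite /wedge raddfB /= !trmx_mul !trmxK opprB.
move: (wedge _ _) (wedgeT (nil_a g) (nil_a k)) => w wT /=.
by rewrite !raddfD /= linearZ /= !nil_skew wT scalerN.
Qed.

Definition nil_mul (g k : nilgroup) : nilgroup :=
  @Nilgroup (nil_a g + nil_a k)
    (nil_c g + nil_c k + 2^-1 *: wedge (nil_a g) (nil_a k)) (nil_mul_skew g k).

Lemma nil0_skew : (0 : 'M['F_p]_r)^T = - 0. Proof. by rewrite trmx0 oppr0. Qed.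

Definition nil_abelian (a : 'cV['F_p]_r) : nilgroup := Nilgroup a nil0_skew.

Definition nil_one : nilgroup := nil_abelian 0.

Lemma nil_inv_skew (g : nilgroup) : (- nil_c g)^T = - (- nil_c g).
Proof. by rewrite linearN /= nil_skew. Qed.

Definition nil_inv (g : nilgroup) : nilgroup :=
  Nilgroup (- nil_a g) (nil_inv_skew g).

End NilpotentGroup.

Section Representation.
Variables (R : realType) (p r : nat).

Local Notation state := 'cV['F_p]_r.
Local Notation wave := {ffun state -> R[i]}.

Definition root_char (z : 'F_p) : R[i] := cis (2 * pi * (z : nat)%:R / p%:R).

Definition mx_pairing (c h : 'M['F_p]_r) : 'F_p := \sum_i \sum_j h i j * c i j.

Definition vec_pairing (a x : state) : 'F_p := \sum_i a i 0 * x i 0.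

Definition Urep (h : 'M['F_p]_r) (g : nilgroup p r) (psi : wave) : wave :=
  [ffun x => root_char (mx_pairing (nil_c g) h + vec_pairing (nil_a g) x)
             * psi (x - h *m nil_a g)].

(* Matrix coefficients in the basis of indicator functions of points. *)
Definition rep_coef (Pi : nilgroup p r -> wave -> wave) (g : nilgroup p r)
    (k k' : state) : R[i] :=
  Pi g [ffun x => (x == k')%:R] k.

Section Connection.
Variables (X : finType) (e : 'I_r -> X * X).

(* The value outside the non-tree edges, and in particular on T, is the
   neutral element. *)
Definition connection (a : X * X) : nilgroup p r :=
  match letter e a with
  | Some (i, true) => nil_abelian (delta_mx i 0)
  | Some (i, false) => nil_inv (nil_abelian (delta_mx i 0))
  | None => nil_one p r
  end.

Definition twisted_trans (Ptr : X -> X -> R)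
    (Pi : nilgroup p r -> wave -> wave) : 'M[R[i]]_(#|{: X * state}|) :=
  \matrix_(a, b)
    let: (x, k) := enum_val a in let: (y, k') := enum_val b in
    (Ptr x y)%:C%C * rep_coef Pi (connection (x, y)) k k'.

End Connection.
End Representation.

Lemma cisD (R : realType) (s t : R) : cis (s + t) = cis s * cis t.
Proof.
rewrite /cis cosD sinD; apply/eqP.
by rewrite eq_complex /= [cos s * sin t + _]addrC !eqxx.
Qed.

Lemma cis_period (R : realType) (t : R) n : cis (t + 2 * pi * n%:R) = cis t.
Proof.
elim: n => [|n IHn]; first by rewrite mulr0 addr0.
have -> : t + 2 * pi * n.+1%:R = t + 2 * pi * n%:R + pi *+ 2.
  by rewrite -[n.+1%:R]natr1 -[pi *+ 2]mulr_natl [in LHS]mulrDr mulr1 addrA.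
by rewrite -IHn /cis cosD2pi sinD2pi.
Qed.

Lemma root_charD (R : realType) (p : nat) (x y : 'F_p) : prime p ->
  root_char R (x + y) = root_char R x * root_char R y.
Proof.
move=> pp; rewrite /root_char -cisD.
have -> : ((x + y)%R : nat) = ((x + y) %% p)%N.
  by rewrite /= [X in (_ %% X)%N](Fp_cast pp).
have p0 : p%:R != 0 :> R by rewrite pnatr_eq0 -lt0n prime_gt0.
move: (2 * pi : R) (@cis_period R) => w wP.
rewrite -mulrDl -mulrDr -natrD [in RHS](divn_eq (x + y) p) natrD mulrDr mulrDl.
by rewrite [in RHS]addrC natrM mulrA mulfK// wP.
Qed.

(* The commutator of e_i and e_j, for which Ncheck i j is 1, acts as the scalar
   of phase 2 h_ij.  More generally a loop with h1 = 0 acts as the scalar of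
   phase <c, h> = 2 sum_(i < j) h_ij Ncheck i j, since both (i, j) and (j, i)
   contribute to <c, h>; the Fourier modes of F are therefore indexed by twice
   the numbers Ncheck i j. *)
Lemma Urep_commutation (R : realType) (p r : nat) (h : 'M['F_p]_r) (i j : 'I_r)
    (psi : {ffun 'cV['F_p]_r -> R[i]}) : prime p -> h^T = - h ->
  let v k := nil_abelian (delta_mx k 0 : 'cV['F_p]_r) in
  Urep h (v i) (Urep h (v j) psi) =
  [ffun x => root_char R (2 * h i j) * Urep h (v j) (Urep h (v i) psi) x].
Proof.
move=> pp hT /=; apply/ffunP => x; rewrite !ffunE /=.
have hji : h j i = - h i j by move/matrixP/(_ i j): hT; rewrite !mxE.
have pair0 : mx_pairing 0 h = 0.
  by apply: big1 => a _; apply: big1 => b _; rewrite mxE mulr0.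
have pairv k (y : 'cV['F_p]_r) : vec_pairing (delta_mx k 0) y = y k 0.
  rewrite /vec_pairing (bigD1 k)//= mxE !eqxx mul1r big1 ?addr0// => a ak.
  by rewrite mxE (negbTE ak) mul0r.
have hv k l : (x - h *m (delta_mx l 0 : 'cV['F_p]_r)) k 0 = x k 0 - h k l.
  by rewrite -colE !mxE.
rewrite pair0 !add0r !pairv !hv hji opprK mulrDl mul1r.
rewrite -[x - _ - _]addrA -[x - _ - h *m delta_mx i 0]addrA.
rewrite [- (h *m delta_mx j 0) - _]addrC !mulrA -!root_charD//.
move: (x i 0) (x j 0) (h i j) => a b c.
congr (root_char R _ * _).
by rewrite [RHS]addrC -!addrA addKr [c + b]addrC.
Qed.

Section Limit.
Variables (R : realType) (r : nat).

Definition pairs := {ij : 'I_r * 'I_r | (ij.1 < ij.2)%N}.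

HB.instance Definition _ := Finite.on pairs.

Local Notation point := (#|{: pairs}|.-tuple R).

Definition pair_coord (u : point) (q : pairs) : R := tnth u (enum_rank q).

Definition hmat (u : point) (p : nat) : 'M['F_p]_r :=
  let upper : 'M['F_p]_r := \matrix_(i, j)
    if (insub (i, j) : option pairs) is Some q
    then (Num.floor (p%:R * pair_coord u q))%:~R else 0 in
  upper - upper^T.

Variables (X : finType) (e : 'I_r -> X * X) (Ptr : X -> X -> R).

Definition log_det (u : point) (p : nat) : R[i] :=
  (p ^ r)%:R^-1 * clog (\det (1%:M - twisted_trans e Ptr (Urep (hmat u p)))).

Definition odd_primes : set_system nat :=
  within [set p : nat | prime p && odd p] \oo.

Definition Flim (u : point) : R[i] :=
  lim ((log_det u p : R[i]^o) @[p --> odd_primes]).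

End Limit.

(* Main.v *)
Require Import Defs.
From HB Require Import structures.
From mathcomp Require Import all_boot all_order all_algebra.
From mathcomp Require Import generic_quotient.
From mathcomp Require Import all_classical all_reals all_analysis.
From mathcomp Require Import measurable_realfun complex.
From mathcomp Require Import ring zify spectral sesquilinear.

Import Order.TTheory GRing.Theory Num.Theory.
Import numFieldNormedType.Exports.

Set Implicit Arguments.
Unset Strict Implicit.
Unset Printing Implicit Defensive.

Local Open Scope classical_set_scope.
Local Open Scope ring_scope.

(* The matrix M = P^(A, U_h) is conjugate to a Hermitian matrix, so that
   log det (I - M) = - sum_n tr (M^n) / n, and tr (M^n) / p^r is bounded by
   tr (P^n), which is summable since P is substochastic and the graph is
   connected.  Expanding tr (M^n) over based loops of length n, the loops with
   non-zero homology mod p have a vanishing holonomy trace, and the others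
   contribute the scalar of phase 2 sum_(i < j) h_ij N_ij; as p grows these
   converge to the phases 2 sum_(i < j) u_ij N_ij.  By dominated convergence
   F u = - sum_n 1/n sum_s w(s) e^(4 i pi <u, N(s)>) over the based loops s of
   length n with zero homology.  A loop l has size l / mult l based
   representatives, so the Fourier coefficients of F are the masses of the
   classes.  The Poisson part is the restriction of the point process to the
   disjoint classes, a loop having degree > 1 iff its homology vanishes. *)

(** [clog] is the principal logarithm, and the principal logarithm of a determinant is in general
    neither the sum of the logarithms of the eigenvalues nor the sum of their power series.
    Reversibility removes this obstacle: the eigenvalues [d i] are real and lie in ]-1, 1[, so every
    factor [1 - d i] is a positive real and [ln] can be used throughout. The bound on the [d i]
    needs no Perron-Frobenius argument: an eigenvalue of modulus at least 1 would keep every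
    even-power trace above 1, whereas for fixed p these traces tend to 0. Homology modulo p detects
    integral homology only for loops shorter than p. The threshold depends on the length, so the
    limit in p is available for each length separately, and a majorant uniform in p is
    indispensable. The reality of F serves a second time: the sines in its expansion cancel, so the
    real and imaginary parts of each Fourier coefficient reduce to integrals of cosines with a
    shifted phase ([mode_coef]). *)

Section FreeGroupAbelianization.

(** * Kernel of the abelianization of the free group *)

Variable r : nat.
Implicit Types (w u v : word r) (x : 'I_r * bool).

Definition abelianize w : 'rV[int]_r :=
  \sum_(x <- w) (if x.2 then 1 else -1) *: delta_mx 0 x.1.

Lemma abelianize_cat u v : abelianize (u ++ v) = abelianize u + abelianize v.
Proof. exact: big_cat. Qed.

Lemma abelianize_inv w : abelianize (inv_word w) = - abelianize w.
Proof.
rewrite /abelianize /inv_word (perm_big _ (permEl (perm_rev _))) big_map.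
rewrite -sumrN; apply: eq_bigr => -[i []] _ /=; rewrite -scaleNr ?opprK//.
Qed.

Lemma inv_letterK : involutive (@inv_letter r).
Proof. by case=> i b; rewrite /inv_letter /= negbK. Qed.

Lemma inv_wordK : involutive (@inv_word r).
Proof.
move=> w; rewrite /inv_word map_rev revK -map_comp map_id_in// => x _ /=.
exact: inv_letterK.
Qed.

Lemma abelianize_free_eq u v : free_eq u v -> abelianize u = abelianize v.
Proof.
elim=> {u v} [u v [i b]| | |]//; last by move=> u v w _ -> _ ->.
rewrite -[in LHS]cat1s -[inv_letter _ :: v]cat1s !abelianize_cat.
rewrite /abelianize !big_seq1 /=; congr (_ + _).
by rewrite addrA -scalerDl; case: b; rewrite /= ?subrr ?addNr scale0r add0r.
Qed.

Lemma abelianize_lower_central n w : lower_central n.+1 w -> abelianize w = 0.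
Proof.
rewrite /=; elim => {w} [w [a [b [_ ->]]]||u v _ IHu _ IHv|w _ IH|u v uv _ IH].
- rewrite /commutator !abelianize_cat !abelianize_inv.
  by rewrite [- abelianize b + _]addrCA addNr addr0 addNr.
- by rewrite /abelianize big_nil.
- by rewrite abelianize_cat IHu IHv addr0.
- by rewrite abelianize_inv IH oppr0.
- by rewrite -(abelianize_free_eq uv).
Qed.

Lemma free_eq_cat2 u u' v v' :
  free_eq u u' -> free_eq v v' -> free_eq (u ++ v) (u' ++ v').
Proof.
move=> uu' vv'; apply: (@free_eq_trans _ _ (u' ++ v)).
  elim: uu' => {u u'} [a b x|u|u u' _ IH|u u' u'' _ IH _ IH'].
  - by rewrite -!catA /=; exact: free_eq_cancel.
  - exact: free_eq_refl.
  - exact: free_eq_sym.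
  - exact: free_eq_trans IH IH'.
elim: vv' => {v v'} [a b x|v|v v' _ IH|v v' v'' _ IH _ IH'].
- by rewrite !catA; exact: free_eq_cancel.
- exact: free_eq_refl.
- exact: free_eq_sym.
- exact: free_eq_trans IH IH'.
Qed.

Lemma free_eq_invl w : free_eq (inv_word w ++ w) [::].
Proof.
elim: w => [|x w IHw]; first exact: free_eq_refl.
rewrite /inv_word /= rev_cons cat_rcons -{2}[x]inv_letterK.
exact: free_eq_trans (free_eq_cancel _ _ _) IHw.
Qed.

(** If the inverse of [x] did not occur in [w], all letters over the generator [x.1] would carry the
    sign [s] of [x], and [s] times that coordinate of the abelianization would be at least 1. *)
Lemma abelianize_eq0_inv_letter x w :
  abelianize (x :: w) = 0 -> inv_letter x \in w.
Proof.
move=> /rowP/(_ x.1); rewrite summxE big_cons !mxE !eqxx mulr1.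
have [//|xw] := boolP (inv_letter x \in w).
set s := if x.2 then _ else _ => /(congr1 ( *%R s)) /=; rewrite mulrDr mulr0.
have -> : s * s = 1 by rewrite /s; case: ifP.
suff : 0 <= s * \sum_(y <- w)
    ((if y.2 then 1 else -1) *: (delta_mx 0 y.1 : 'rV[int]_r)) 0 x.1.
  by move=> h /eqP; rewrite gt_eqF// ltr_pwDl.
rewrite mulr_sumr big_seq sumr_ge0// => -[i b] yw; rewrite !mxE /=.
have [xi|] := eqVneq x.1 i; last by rewrite !mulr0.
rewrite mulr1 /s; case: x xw xi {s} => j c /= xw jE.
move: xw yw; rewrite jE /inv_letter /=.
by case: b c => -[] //= /negP h1 h2.
Qed.

(* Modulo commutators the first letter of a word can be moved next to an
   occurrence of its inverse, which exists when the abelianization vanishes. *)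
Lemma abelianize_eq0_lower_central w : abelianize w = 0 -> lower_central 1 w.
Proof.
have [n] := ubnP (size w); elim: n w => // n IHn [|x w] /=.
  by move=> _ _; exact: generated_1.
rewrite ltnS => wn ab0; have := abelianize_eq0_inv_letter ab0.
move=> /splitPr xw; case: xw ab0 wn => u v ab0 wn.
(* The convention is [a, b] = a^-1 b^-1 a b, so a = x^-1 and b = u^-1 give x u x^-1 u^-1; multiplied
   by u v this reduces to x u x^-1 v. *)
apply: (@generated_eq _ _
  (commutator [:: inv_letter x] (inv_word u) ++ (u ++ v))).
  rewrite /commutator inv_wordK /inv_word /= inv_letterK -/(inv_word u).
  apply: (@free_eq_cat2 [:: x] [:: x]); first exact: free_eq_refl.
  rewrite -!catA; apply: free_eq_cat2; first exact: free_eq_refl.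
  apply: (@free_eq_cat2 [:: inv_letter x] [:: inv_letter x]).
    exact: free_eq_refl.
  rewrite -/(inv_word u ++ u ++ v) catA.
  apply: (@free_eq_cat2 _ [::] v); first exact: free_eq_invl.
  exact: free_eq_refl.
apply: generated_mul; first by apply: generated_in; eexists; eexists; split.
apply: IHn.
  by move: wn; rewrite !size_cat /= addnS; apply: leq_trans; rewrite ltnS.
move: ab0; rewrite -cat1s -[inv_letter x :: v]cat1s !abelianize_cat => <-.
rewrite addrCA; congr (_ + _); rewrite addrA /abelianize !big_seq1 -scalerDl.
by rewrite /inv_letter; case: x.2 => /=; rewrite ?subrr ?addNr scale0r add0r.
Qed.

End FreeGroupAbelianization.

(** Since [lower_central n] is Gamma^(n+1), the supremum exceeds 1 when some positive index
    qualifies. Index 1 does if the abelianization vanishes, because its kernel is stable under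
    conjugation and contained in [lower_central 1]; otherwise testing the word itself excludes every
    index but 0. *)
Lemma degree_gt1 (R : realType) (X : finType) (E : rel X) (r : nat)
    (e : 'I_r -> X * X) (l : loop E) :
  (1 < degree R e l)%E <-> h1 e l = 0.
Proof.
rewrite -[h1 e l]/(abelianize (homotopy_word e (based_at l))).
set w := homotopy_word e _; split=> [|w0].
  apply: contraPP => /eqP w0; apply/negP; rewrite -leNgt.
  apply: ge_ereal_sup => _ [[|n] nw <-]//; exfalso; move: w0; apply/negP.
  rewrite negbK; apply/eqP/(@abelianize_lower_central _ n)/nw.
  by exists [::]; rewrite cats0; exact: free_eq_refl.
apply: (@lt_le_trans _ _ 2%:R%:E); first by rewrite lte_fin ltr1n.
apply: ereal_sup_ubound; exists 1%N => //= w' [v w'v].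
apply: abelianize_eq0_lower_central.
rewrite (abelianize_free_eq w'v) !abelianize_cat abelianize_inv w0 add0r.
exact: subrr.
Qed.

(** * Steps of a loop and signed crossing numbers *)

Lemma zip_rot (S T : Type) k (s : seq S) (t : seq T) : size s = size t ->
  zip (rot k s) (rot k t) = rot k (zip s t).
Proof.
move=> st; rewrite /rot zip_cat ?size_drop ?st//; congr (_ ++ _).
  by elim: k s t st => [|k IHk] [|x s] [|y t] //= [/IHk].
by elim: k s t st => [|k IHk] [|x s] [|y t] //= [/IHk ->].
Qed.

Lemma steps_rot (X : finType) k (s : seq X) : steps (rot k s) = rot k (steps s).
Proof. by rewrite /steps rot_rot zip_rot// size_rot. Qed.

Lemma steps_cons (X : finType) x (t : seq X) :
  steps (x :: t) = zip (x :: t) (rcons t x).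
Proof. by rewrite /steps rot1_cons. Qed.

Lemma size_steps (X : finType) (s : seq X) : size (steps s) = size s.
Proof. by rewrite size_zip size_rot minnn. Qed.

Section Crossings.
Variables (X : finType) (r : nat) (e : 'I_r -> X * X).
Implicit Types (a b : X * X) (st : seq (X * X)).

Definition edge_sign (i : 'I_r) a : int :=
  (e i == a)%:Z - (e i == opp_edge a)%:Z.

Definition net_crossings (i : 'I_r) st : int := \sum_(a <- st) edge_sign i a.

(** A discrete iterated integral: the sum over times s < t of [edge_sign i] at s times [edge_sign j]
    at t. The recursive form gives the concatenation formula at once, unlike the cardinals in
    [crossings]. *)
Fixpoint pair_crossings (i j : 'I_r) st : int :=
  if st is a :: st' then
    edge_sign i a * net_crossings j st' + pair_crossings i j st'
  else 0.

Lemma opp_edgeK : involutive (@opp_edge X).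
Proof. by case. Qed.

Lemma edge_sign_opp i a : edge_sign i (opp_edge a) = - edge_sign i a.
Proof. by rewrite /edge_sign opp_edgeK opprB. Qed.

Lemma net_crossings_cons i a st :
  net_crossings i (a :: st) = edge_sign i a + net_crossings i st.
Proof. exact: big_cons. Qed.

Lemma net_crossings_cat i st st' :
  net_crossings i (st ++ st') = net_crossings i st + net_crossings i st'.
Proof. exact: big_cat. Qed.

Lemma net_crossings_rot i k st :
  net_crossings i (rot k st) = net_crossings i st.
Proof. by rewrite net_crossings_cat addrC -net_crossings_cat cat_take_drop. Qed.

(** Chen's identity: the product term collects the pairs of times with the first in [st] and the
    second in [st']. *)
Lemma pair_crossings_cat i j st st' : pair_crossings i j (st ++ st') =
  pair_crossings i j st + pair_crossings i j st'
  + net_crossings i st * net_crossings j st'.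
Proof.
elim: st => [|a st IH] /=.
  by rewrite add0r /net_crossings big_nil mul0r addr0.
by rewrite IH net_crossings_cat net_crossings_cons; ring.
Qed.

(** A rotation exchanges two blocks s and t. Only the cross term changes, from N_i(s) N_j(t) to
    N_i(t) N_j(s); as the totals vanish, both equal -N_i(t) N_j(t). *)
Lemma pair_crossings_rot i j k st :
  net_crossings i st = 0 -> net_crossings j st = 0 ->
  pair_crossings i j (rot k st) = pair_crossings i j st.
Proof.
rewrite -{1 2 4}[st](cat_take_drop k) !net_crossings_cat /rot.
move: (take _ _) (drop _ _) => s t /eqP; rewrite addr_eq0 => /eqP hi /eqP.
rewrite addr_eq0 => /eqP hj; rewrite !pair_crossings_cat hi hj mulNr mulrN.
by rewrite [X in X + _ = _]addrC.
Qed.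

(** Shuffle relation: the product of two net crossings splits according to the order of the two
    times, the last sum being that of coinciding times. *)
Lemma pair_crossingsC i j st :
  pair_crossings i j st + pair_crossings j i st
  + \sum_(a <- st) edge_sign i a * edge_sign j a
  = net_crossings i st * net_crossings j st.
Proof.
elim: st => [|a st IH] /=.
  by rewrite /net_crossings !big_nil mul0r !addr0.
rewrite big_cons !net_crossings_cons.
transitivity (edge_sign i a * edge_sign j a + edge_sign i a * net_crossings j st
  + edge_sign j a * net_crossings i st + net_crossings i st * net_crossings j st).
  by rewrite -IH; ring.
by ring.
Qed.

Definition seq_crossings (f g : X * X) st : nat :=
  #|[set ab : 'I_(size st) * 'I_(size st) |
      [&& (ab.1 < ab.2)%N, tnth (in_tuple st) ab.1 == f
        & tnth (in_tuple st) ab.2 == g]]%SET|.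

Lemma seq_crossingsE (f g : X * X) (st : seq (X * X)) c0 :
  seq_crossings f g st =
  (\sum_(a < size st) \sum_(b < size st)
    [&& (a < b), nth c0 st a == f & nth c0 st b == g])%N.
Proof.
rewrite /seq_crossings cardsE -sum1_card pair_big /= big_mkcond /=.
apply: eq_bigr => -[a b] _; rewrite unfold_in /= !(tnth_nth c0) /=.
by case: ifP.
Qed.

Lemma seq_crossings_cons f g c st : seq_crossings f g (c :: st) =
  ((c == f) * count_mem g st + seq_crossings f g st)%N.
Proof.
rewrite !(seq_crossingsE _ _ _ c) /= big_ord_recl /=.
congr (_ + _)%N.
  rewrite big_ord_recl /= add0n -sum1_count [in RHS]big_mkcond/=.
  rewrite [in RHS](big_nth c) big_mkord big_distrr/=; apply: eq_bigr => i _.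
  by case: (c == f); case: (_ == g).
apply: eq_bigr => i _; rewrite big_ord_recl /= add0n.
by apply: eq_bigr => j _.
Qed.

(** The four signed terms are the expanded product of two differences [edge_sign], so both sides
    obey the same recursion on the first step. *)
Lemma signed_crossingsE i j s :
  signed_crossings e i j s = pair_crossings i j (steps s).
Proof.
rewrite /signed_crossings /crossings -!/(seq_crossings _ _ (steps s)).
have countE f st : (count_mem f st)%:Z = \sum_(a <- st) (f == a)%:Z.
  elim: st => [|a st IH]; rewrite ?big_nil// big_cons -IH /= eq_sym.
  by rewrite PoszD.
elim: (steps s) => [|a st IH] /=.
  rewrite /seq_crossings !eq_card0 ?subrr// => -[[]]//.
rewrite -IH !seq_crossings_cons !PoszD !PoszM !countE.
rewrite /net_crossings /edge_sign sumrB.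
have oppE k b : (e k == opp_edge b) = (opp_edge (e k) == b).
  by rewrite (can2_eq opp_edgeK opp_edgeK).
under [X in _ * (_ - X)]eq_bigr do rewrite oppE.
rewrite oppE ![a == _]eq_sym.
move: (e i == a)%:Z (opp_edge (e i) == a)%:Z => x y.
move: (\sum_(_ <- _) _) (\sum_(_ <- _) _) => z t.
move: (seq_crossings _ _ _)%:Z (seq_crossings _ _ _)%:Z.
move: (seq_crossings _ _ _)%:Z (seq_crossings _ _ _)%:Z => p q u v.
ring.
Qed.

Hypothesis e_inj : forall i j, e i = e j -> i = j.
Hypothesis e_opp : forall i j, e i <> opp_edge (e j).

Lemma edge_sign_letter i a : edge_sign i a =
  if letter e a is Some (j, b) then (j == i)%:Z * (if b then 1 else -1) else 0.
Proof.
rewrite /edge_sign /letter; case: pickP => [j /eqP ja|ja].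
  rewrite -ja; have [ij|ij] := eqVneq (e i) (opp_edge (e j)).
    by have := e_opp ij.
  by rewrite subr0 mulr1; congr (Posz (nat_of_bool _)); rewrite [RHS]eq_sym;
    apply/eqP/eqP => [/e_inj|->].
rewrite ja sub0r; case: pickP => [j /eqP ja'|->]; last by rewrite oppr0.
rewrite -ja' mulrN1; congr (- Posz (nat_of_bool _)); rewrite [RHS]eq_sym.
by apply/eqP/eqP => [/e_inj|->].
Qed.

Lemma edge_sign_mul i j a : i != j -> edge_sign i a * edge_sign j a = 0.
Proof.
move=> ij; rewrite !edge_sign_letter; case: (letter e a) => [[k b]|]//.
have [->|ki] := eqVneq k i; first by rewrite (negbTE ij) mul0r mulr0.
by rewrite mul0r mul0r.
Qed.

(** In the shuffle relation the product vanishes, and so does the diagonal, since one step cannot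
    cross both the edge of [e i] and that of [e j]. *)
Lemma pair_crossings_antisym i j st : i != j ->
  net_crossings i st = 0 -> pair_crossings j i st = - pair_crossings i j st.
Proof.
move=> ij i0; have := pair_crossingsC i j st; rewrite i0 mul0r big1.
  by rewrite addr0 addrC => /eqP; rewrite addr_eq0 => /eqP.
by move=> a _; exact: edge_sign_mul.
Qed.

Lemma h1E (E : rel X) (l : loop E) :
  h1 e l = \row_i net_crossings i (steps (based_at l)).
Proof.
apply/rowP => i; rewrite /h1 /homotopy_word mxE; move: (steps _) => st.
elim: st => [|a st IH] /=; first by rewrite /net_crossings !big_nil mxE.
rewrite net_crossings_cons -IH edge_sign_letter.
case: (letter e a) => [[j b]|] /=; last by rewrite add0r.
by rewrite big_cons !mxE /= eq_sym; congr (_ + _); rewrite mulrC natz.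
Qed.

End Crossings.

Lemma big_tuple_cons (R : Type) (idx : R) (op : Monoid.com_law idx)
    (X : finType) n (F : n.+1.-tuple X -> R) :
  \big[op/idx]_(t : n.+1.-tuple X) F t =
  \big[op/idx]_x \big[op/idx]_(t : n.-tuple X) F [tuple of x :: t].
Proof.
rewrite pair_bigA /= (reindex (fun xt : X * n.-tuple X => [tuple of xt.1 :: xt.2])).
  by [].
exists (fun t => (thead t, [tuple of behead t])) => [[x t] _|t _] /=.
  by congr pair; apply/val_inj.
by rewrite [RHS]tuple_eta; apply/val_inj.
Qed.

Lemma sum_symmetric_pairs (K : comPzRingType) r (F : 'I_r -> 'I_r -> K) :
  (forall i, F i i = 0) -> (forall i j, F i j = F j i) ->
  \sum_i \sum_j F i j = 2 * \sum_(q : pairs r) F (val q).1 (val q).2.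
Proof.
move=> F0 FC; have -> : \sum_i \sum_j F i j =
    \sum_(i < r) \sum_(j < r | (i < j)%N) F i j
    + \sum_(i < r) \sum_(j < r | (j < i)%N) F i j.
  rewrite -big_split /=; apply: eq_bigr => i _.
  rewrite (bigID (fun j : 'I_r => (i < j)%N)) /=; congr (_ + _).
  rewrite (bigD1 i) ?ltnn//= F0 add0r; apply: eq_bigl => j.
  by rewrite -leqNgt ltn_neqAle andbC.
rewrite [X in _ + X](exchange_big_dep xpredT)//=.
under [X in _ + X]eq_bigr do under eq_bigr do rewrite FC.
rewrite -[LHS]mulr2n -[LHS]mulr_natl pair_big_dep /=; congr (_ * _).
by rewrite -(big_sub (fun ij : 'I_r * 'I_r => (ij.1 < ij.2)%N)
  (fun ij => F ij.1 ij.2)).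
Qed.

(** * Additive characters of the prime field *)

Section RootOfUnity.
Variables (R : realType) (p : nat).
Hypothesis p_prime : prime p.

Lemma root_char0 : root_char R (0 : 'F_p) = 1.
Proof. by rewrite /root_char /= mulr0 mul0r /cis cos0 sin0. Qed.

Lemma root_char_neq0 (z : 'F_p) : root_char R z != 0.
Proof.
apply/eqP => z0; have := root_char0; rewrite -(subrr z) root_charD// z0 mul0r.
by move=> /eqP; rewrite eq_sym oner_eq0.
Qed.

Lemma cis0 : cis 0 = 1 :> R[i].
Proof. by rewrite /cis cos0 sin0. Qed.

Lemma root_char1 : root_char R (1 : 'F_p) = cis (2 * pi / p%:R).
Proof.
rewrite /root_char (_ : ((1%R : 'F_p) : nat) = 1%N) ?mulr1//.
Qed.

Lemma root_char_nat n : root_char R (n%:R : 'F_p) = cis (2 * pi * n%:R / p%:R).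
Proof.
elim: n => [|n IH]; first by rewrite root_char0 mulr0 mul0r cis0.
rewrite -natr1 root_charD// IH root_char1 -cisD; congr cis.
by rewrite -[in RHS]natr1; move: p%:R^-1 => c; ring.
Qed.

Lemma root_char_int (z : int) :
  root_char R (z%:~R : 'F_p) = cis (2 * pi * z%:~R / p%:R).
Proof.
case: z => n; first exact: root_char_nat.
rewrite NegzE !mulrNz; apply: (mulfI (root_char_neq0 n.+1%:R)).
rewrite -root_charD// subrr root_char0 root_char_nat -cisD mulrN mulNr subrr.
by rewrite cis0.
Qed.

(** For p > 2 the angle 2 pi / p lies strictly between 0 and pi, where the sine is positive. *)
Lemma root_char1_neq1 : odd p -> root_char R (1 : 'F_p) != 1.
Proof.
move=> p_odd; rewrite root_char1 /cis; apply/eqP => -[_] /eqP.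
rewrite gt_eqF// sin_gt0_pi// divr_gt0 ?mulr_gt0 ?pi_gt0 ?ltr0n ?prime_gt0//=.
rewrite ltr_pdivrMr ?ltr0n ?prime_gt0// mulrC ltr_pM2l ?pi_gt0//.
by rewrite ltr_nat odd_prime_gt2.
Qed.

Lemma Fp_int_eq0 (z : int) : (`|z| < p)%N ->
  ((z%:~R : 'F_p) == 0) = (z == 0).
Proof.
have nat_eq0 n : (n < p)%N -> ((n%:R : 'F_p) == 0) = (n == 0)%N.
  move=> np; rewrite -(dvdn_pcharf (pchar_Fp p_prime)).
  by case: n np => [|n] np; rewrite ?dvdn0// gtnNdvd.
by case: z => n np; rewrite ?NegzE ?mulrNz ?oppr_eq0; exact: nat_eq0.
Qed.

Lemma Re_cis_le1 (t : R) (b : bool) :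
  `|complex.Re (cis t * b%:R)| <= 1.
Proof.
case: b; last by rewrite mulr0 /= normr0.
by rewrite mulr1 /=; exact/cos_max.
Qed.

End RootOfUnity.

(** * Holonomy along walks and twisted traces *)

Section TwistedTrace.
Variables (R : realType) (X : finType) (r : nat) (e : 'I_r -> X * X).
Hypothesis e_inj : forall i j, e i = e j -> i = j.
Hypothesis e_opp : forall i j, e i <> opp_edge (e j).
Variables (p : nat) (Ptr : X -> X -> R) (h : 'M['F_p]_r).
Hypothesis p_prime : prime p.
Implicit Types (a : X * X) (st : seq (X * X)) (k : 'cV['F_p]_r).

Lemma vec_pairingDl k k' x :
  vec_pairing (k + k') x = vec_pairing k x + vec_pairing k' x.
Proof.
by rewrite /vec_pairing -big_split; apply: eq_bigr => i _; rewrite mxE mulrDl.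
Qed.

Lemma vec_pairingNl k x : vec_pairing (- k) x = - vec_pairing k x.
Proof.
by rewrite /vec_pairing -sumrN; apply: eq_bigr => i _; rewrite mxE mulNr.
Qed.

Lemma vec_pairingBr k x y :
  vec_pairing k (x - y) = vec_pairing k x - vec_pairing k y.
Proof.
by rewrite /vec_pairing -sumrB; apply: eq_bigr => i _; rewrite !mxE mulrBr.
Qed.

Definition edge_vec a : 'cV['F_p]_r := \col_i (edge_sign e i a)%:~R.

Definition net_vec st : 'cV['F_p]_r := \sum_(a <- st) edge_vec a.

Lemma net_vecE st i : net_vec st i 0 = (net_crossings e i st)%:~R.
Proof.
rewrite /net_vec summxE /net_crossings raddf_sum /=.
by apply: eq_bigr => a _; rewrite mxE.
Qed.

Lemma nil_a_connection a : nil_a (connection p e a) = edge_vec a.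
Proof.
apply/colP => i; rewrite mxE edge_sign_letter// /connection.
case: (letter e a) => [[j []]|] /=; rewrite ?mxE//= eq_sym ?andbT ?mulr1//.
by rewrite mulrN1 mulrNz.
Qed.

Lemma nil_c_connection a : nil_c (connection p e a) = 0.
Proof.
by rewrite /connection; case: letter => [[j []]|] //=; rewrite oppr0.
Qed.

Local Notation M := (twisted_trans e Ptr (Urep h)).

Lemma twisted_transE x k y k' :
  M (enum_rank (x, k)) (enum_rank (y, k')) =
  (Ptr x y)%:C%C * (root_char R (vec_pairing (edge_vec (x, y)) k)
                    * (k - h *m edge_vec (x, y) == k')%:R).
Proof.
rewrite mxE !enum_rankK /rep_coef !ffunE nil_a_connection nil_c_connection.
congr (_ * (root_char R _ * _)); rewrite -[RHS]add0r; congr (_ + _).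
by apply: big1 => i _; apply: big1 => j _; rewrite mxE mulr0.
Qed.

(** Exponent of the character accumulated along a walk: crossing [a] evaluates the character of
    [edge_vec a] at the current state, then translates the state by [- h *m edge_vec a]. The central
    component of the connection is 0 and contributes no phase. *)
Fixpoint walk_phase st k : 'F_p :=
  if st is a :: st' then
    vec_pairing (edge_vec a) k + walk_phase st' (k - h *m edge_vec a)
  else 0.

(** The state before each step is [k] minus [h] applied to the net vector of the earlier steps.
    Pairing it with the step yields h_ij times crossings of e_j that precede crossings of e_i,
    whence the exchanged indices. *)
Lemma walk_phaseE st k : walk_phase st k = vec_pairing (net_vec st) k
  - \sum_i \sum_j h i j * (pair_crossings e j i st)%:~R.
Proof.
elim: st k => [|a st IH] k /=.
  rewrite /net_vec big_nil /vec_pairing !big1 ?subrr// => i _.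
    by rewrite big1// => j _; rewrite mulr0.
  by rewrite mxE mul0r.
rewrite IH /net_vec big_cons -/(net_vec st) vec_pairingDl vec_pairingBr.
rewrite -!addrA; congr (_ + (_ + _)); rewrite -opprD; congr (- _).
rewrite -big_split /=; apply: eq_bigr => i _.
rewrite mxE mulr_sumr -big_split /=; apply: eq_bigr => j _.
by rewrite net_vecE [(_ * _ + _)%:~R]intrD intrM mxE mulrDr; congr (_ + _); ring.
Qed.

Definition walk_coef st k k' : R[i] :=
  root_char R (walk_phase st k) * (k - h *m net_vec st == k')%:R.

Lemma walk_coef_cons a st k k' : walk_coef (a :: st) k k' =
  root_char R (vec_pairing (edge_vec a) k)
  * walk_coef st (k - h *m edge_vec a) k'.
Proof.
rewrite /walk_coef [walk_phase (_ :: _) _]/= root_charD// -mulrA.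
by rewrite /net_vec big_cons mulmxDr opprD addrA.
Qed.

(** The operator attached to an edge is a translation times a diagonal matrix, so for each walk of
    vertices a single sequence of internal states contributes. *)
Lemma twisted_trans_pow n x k y k' :
  (M ^+ n.+1) (enum_rank (x, k)) (enum_rank (y, k')) =
  \sum_(t : n.-tuple X) let st := zip (x :: t) (rcons t y) in
    (\prod_(a <- st) Ptr a.1 a.2)%:C%C * walk_coef st k k'.
Proof.
elim: n x k => [|n IH] x k.
  rewrite expr1 twisted_transE [in RHS](bigD1 [tuple])//=.
  rewrite [X in _ = _ + X]big1 ?addr0.
    by rewrite /walk_coef /net_vec /= !big_seq1 addr0.
  by move=> t /eqP; rewrite tuple0.
rewrite exprS big_tuple_cons /= mxE (reindex (@enum_rank _)); last first.
  exact/onW_bij/enum_rank_bij.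
transitivity (\sum_z \sum_k1 M (enum_rank (x, k)) (enum_rank (z, k1)) *
    (M ^+ n.+1) (enum_rank (z, k1)) (enum_rank (y, k'))).
  by rewrite pair_bigA; apply: eq_bigr => -[].
apply: eq_bigr => z _; rewrite (bigD1 (k - h *m edge_vec (x, z)))//=.
rewrite [X in _ + X]big1 ?addr0; last first.
  move=> k1 /negbTE k1E; rewrite twisted_transE eq_sym k1E.
  by rewrite !mulr0 mul0r.
rewrite twisted_transE eqxx mulr1 IH mulr_sumr; apply: eq_bigr => t _ /=.
rewrite !big_cons /= rmorphM /= -!mulrA; congr (_ * _).
rewrite [LHS]mulrCA; congr (_ * _).
by rewrite walk_coef_cons.
Qed.

Definition holonomy_trace st : R[i] := \sum_k walk_coef st k k.

Lemma mxtrace_twisted_trans n : \tr (M ^+ n.+1) =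
  \sum_(s : n.+1.-tuple X)
    (\prod_(a <- steps s) Ptr a.1 a.2)%:C%C * holonomy_trace (steps s).
Proof.
rewrite big_tuple_cons /mxtrace (reindex (@enum_rank _)); last first.
  exact/onW_bij/enum_rank_bij.
transitivity (\sum_x \sum_k
    (M ^+ n.+1) (enum_rank (x, k)) (enum_rank (x, k))).
  by rewrite pair_bigA; apply: eq_bigr => -[].
apply: eq_bigr => x _; under eq_bigr do rewrite twisted_trans_pow.
rewrite exchange_big /=; apply: eq_bigr => t _.
by rewrite -mulr_sumr steps_cons.
Qed.

Lemma card_state : #|{: 'cV['F_p]_r}| = (p ^ r)%N.
Proof. by rewrite card_mx card_Fp// muln1. Qed.

Lemma Re_holonomy_trace_le st :
  `|complex.Re (holonomy_trace st)| <= (p ^ r)%:R.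
Proof.
rewrite /holonomy_trace raddf_sum /= (le_trans (ler_norm_sum _ _ _))//.
rewrite -card_state -sum1_card natr_sum; apply: ler_sum => k _.
exact: Re_cis_le1.
Qed.

(** A translation by a nonzero [h *m V] fixes no state. If [h *m V] is zero, the diagonal entries
    are, up to a constant factor, the values of a nontrivial character of the state space, which sum
    to 0. *)
Lemma holonomy_trace_neq0 st : odd p -> net_vec st != 0 ->
  holonomy_trace st = 0.
Proof.
move=> p_odd V0; rewrite /holonomy_trace /walk_coef.
under eq_bigr do rewrite walk_phaseE root_charD//.
set V := net_vec st in V0 *; set c := root_char R (- _).
have [hV|hV] := eqVneq (h *m V) 0; last first.
  apply: big1 => k _.
  by rewrite -subr_eq0 addrAC subrr add0r oppr_eq0 (negbTE hV) mulr0.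
under eq_bigr do rewrite hV subr0 eqxx mulr1.
rewrite -mulr_suml; apply/eqP; rewrite mulf_eq0; apply/orP; left.
have [i Vi] : exists i, V i 0 != 0.
  by apply/existsP; apply: contraNT V0; rewrite negb_exists => /forallP V0;
    apply/eqP/colP => i; rewrite mxE; apply/eqP; rewrite -[_ == _]negbK.
(* Chosen to pair to 1 with [V]: translating [k] by [b] multiplies the sum [S] by [root_char R 1],
   which is not 1 as p is odd. *)
pose b : 'cV['F_p]_r := (V i 0)^-1 *: delta_mx i 0.
have Vb : vec_pairing V (- b) = - 1.
  rewrite /vec_pairing (bigD1 i)//= big1 ?addr0 ?mxE ?eqxx ?mulr1.
    by rewrite mulrN mulfV.
  by move=> j /negbTE ji; rewrite !mxE ji mulr0 oppr0 mulr0.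
set S := \sum_k _; have : S = root_char R (1 : 'F_p) * S.
  rewrite /S mulr_sumr [LHS](reindex_inj (addIr b)) /=; apply: eq_bigr => k _.
  rewrite -root_charD// -{1}[b]opprK vec_pairingBr Vb opprK addrC//.
move=> /eqP; rewrite -subr_eq0 -{1}[S]mul1r -mulrBl mulf_eq0 subr_eq0 eq_sym.
by rewrite (negbTE (root_char1_neq1 _ _ _)).
Qed.

(** With zero net vector each of the p^r states is fixed and gets the same phase, - sum h_ij N_ji.
    Off the diagonal N is skew, which makes it sum h_ij N_ij; the terms are symmetric in i and j and
    vanish on the diagonal, hence twice the sum over i < j. *)
Lemma holonomy_trace_eq0 st : (forall i j, h j i = - h i j) ->
  (forall i, h i i = 0) -> (forall i, net_crossings e i st = 0) ->
  holonomy_trace st = (p ^ r)%:R * root_char R (2 * \sum_(q : pairs r)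
    h (val q).1 (val q).2 * (pair_crossings e (val q).1 (val q).2 st)%:~R).
Proof.
move=> hN h0 net0; have V0 : net_vec st = 0.
  by apply/colP => i; rewrite net_vecE net0 mxE.
rewrite /holonomy_trace /walk_coef; under eq_bigr => k _.
  rewrite walk_phaseE V0 mulmx0 subr0 eqxx mulr1.
  rewrite [vec_pairing 0 k]big1; last by move=> i _; rewrite mxE mul0r.
  rewrite add0r; over.
rewrite sumr_const card_state -[LHS]mulr_natl; congr (_ * root_char R _).
rewrite -(sum_symmetric_pairs (F := fun i j =>
  h i j * (pair_crossings e i j st)%:~R)); last 2 first.
- by move=> i; rewrite h0 mul0r.
- move=> i j; have [->//|ij] := eqVneq i j.
  by rewrite (pair_crossings_antisym e_inj e_opp ij)// (hN i j) mulrNz mulrNN.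
rewrite -sumrN; apply: eq_bigr => i _; rewrite -sumrN; apply: eq_bigr => j _.
have [->//|ij] := eqVneq i j; first by rewrite h0 !mul0r oppr0.
by rewrite (pair_crossings_antisym e_inj e_opp ij)// mulrNz mulrN opprK.
Qed.

End TwistedTrace.

(** * Real spectrum from detailed balance *)

Section ReversibleSpectrum.
Variable R : realType.

Lemma mxpow_conj (F : comUnitRingType) n (Q D : 'M[F]_n) m : Q \in unitmx ->
  (invmx Q *m D *m Q) ^+ m = invmx Q *m D ^+ m *m Q.
Proof.
move=> Qu; elim: m => [|m IH]; first by rewrite !expr0 mulmx1 mulVmx.
by rewrite !exprS IH !mulmxE -!mulmxE !mulmxA mulmxK.
Qed.

Lemma diag_mx_pow (F : comPzRingType) n (d : 'rV[F]_n) m :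
  diag_mx d ^+ m = diag_mx (\row_i d 0 i ^+ m).
Proof.
elim: m => [|m IH].
  by rewrite expr0; apply/matrixP => i j; rewrite !mxE expr0.
rewrite exprS IH -mulmxE mul_diag_mx; apply/matrixP => i j.
by rewrite !mxE exprS mulrnAr.
Qed.

Lemma conjcM (a b : R[i]) : (a * b)^*%C = a^*%C * b^*%C.
Proof. exact: rmorphM. Qed.

(* Conjugation by the diagonal matrix of the square roots of [lam] makes the
   matrix Hermitian. *)
Lemma reversible_spectrum n (M : 'M[R[i]]_n) (lam : 'I_n -> R) :
  (forall i, 0 < lam i) ->
  (forall i j, (lam i)%:C%C * M i j = (lam j)%:C%C * (M j i)^*%C) ->
  exists d : 'I_n -> R,
    (forall m, \tr (M ^+ m) = (\sum_i d i ^+ m)%:C%C) /\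
    \det (1%:M - M) = (\prod_i (1 - d i))%:C%C.
Proof.
move=> lam_gt0 Msym.
pose s i : R[i] := (Num.sqrt (lam i))%:C%C.
have s0 i : s i != 0.
  by rewrite /s; apply/eqP => -[] /eqP; rewrite gt_eqF// sqrtr_gt0.
have ss i : s i * s i = (lam i)%:C%C.
  by rewrite /s -rmorphM /= -expr2 sqr_sqrtr// ltW.
have sJ i : (s i)^*%C = s i by rewrite conjc_real.
pose H : 'M[R[i]]_n := \matrix_(i, j) (s i * M i j / s j).
have Hherm : H \is hermsymmx.
  apply/is_hermitianmxP; rewrite expr0 scale1r; apply/matrixP => i j.
  rewrite !mxE; change (s i * M i j / s j = (s j * M j i / s i)^*%C).
  rewrite !conjcM conjc_inv !sJ.
  apply: (mulfI (s0 i)); apply: (mulIf (s0 j)).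
  by rewrite mulrA divfK// mulrA ss Msym -ss mulrCA divff// mulr1; ring.
have Hd := orthomx_spectralP (hermitian_normalmx Hherm).
have dreal := hermitian_spectral_diag_real Hherm.
pose S := diag_mx (\row_i s i).
have Su : S \in unitmx.
  by rewrite unitmxE det_diag unitfE; apply/prodf_neq0 => i _; rewrite mxE.
have Vu := spectral_unit H.
set V := spectralmx H in Hd Vu; set D := spectral_diag H in Hd dreal.
have Qu : V *m S \in unitmx by rewrite unitmx_mul Vu.
have ME : M = invmx (V *m S) *m diag_mx D *m (V *m S).
  have SM : S *m M = H *m S.
    rewrite /S mul_diag_mx mul_mx_diag; apply/matrixP => i j.
    by rewrite !mxE divfK.
  apply: (can_inj (mulKmx Qu)); rewrite -[LHS]mulmxA SM Hd !mulmxA.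
  by rewrite (mulmxV Vu) mul1mx (mulmxV Qu) mul1mx.
pose d i := complex.Re (D 0 i).
have dE i : D 0 i = (d i)%:C%C.
  by apply/esym/RRe_real; move/mxOverP : dreal; exact.
exists d; split=> [m|].
  rewrite ME mxpow_conj// mxtrace_mulC mulmxA (mulmxV Qu) mul1mx diag_mx_pow.
  rewrite mxtrace_diag rmorph_sum /=; apply: eq_bigr => i _.
  by rewrite mxE dE rmorphXn.
have -> : 1%:M - M = invmx (V *m S) *m (1%:M - diag_mx D) *m (V *m S).
  by rewrite mulmxBr mulmxBl -ME mulmx1 (mulVmx Qu).
have Qdet : \det (V *m S) != 0 by rewrite -unitfE -unitmxE.
rewrite det_mulmx [X in X * _]det_mulmx det_inv mulrAC (mulVf Qdet) mul1r.
rewrite -diag_const_mx -linearB /= det_diag rmorph_prod /=.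
by apply: eq_bigr => i _; rewrite !mxE dE rmorphB rmorph1.
Qed.

End ReversibleSpectrum.

Section TwistedSpectrum.
Variables (R : realType) (X : finType) (r : nat) (e : 'I_r -> X * X).
Hypothesis e_inj : forall i j, e i = e j -> i = j.
Hypothesis e_opp : forall i j, e i <> opp_edge (e j).
Variables (C : X -> X -> R) (kappa : X -> R).
Hypothesis C_sym : forall x y, C x y = C y x.
Hypothesis lambda_gt0 : forall x, 0 < lambda C kappa x.
Variables (p : nat) (h : 'M['F_p]_r).
Hypothesis p_prime : prime p.
Hypothesis h_diag : forall i, h i i = 0.

Lemma root_charJ (z : 'F_p) : (root_char R z)^*%C = root_char R (- z).
Proof.
apply: (mulfI (root_char_neq0 R p_prime z)).
rewrite -root_charD// subrr root_char0 /root_char /cis.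
set t := (X in cos X); apply/eqP; rewrite eq_complex /= mulrN opprK -!expr2.
by rewrite cos2Dsin2 eqxx /= mulrN mulrC addNr.
Qed.

Lemma edge_vec_opp a : edge_vec e p (opp_edge a) = - edge_vec e p a.
Proof. by apply/colP => i; rewrite !mxE edge_sign_opp mulrNz. Qed.

(** A step has at most one nonzero coordinate and [h] has zero diagonal. The reversed step starts
    from [k - h *m edge_vec a]; thanks to this identity its phase there is opposite to that of the
    step at [k]. *)
Lemma edge_vec_isotropic a :
  vec_pairing (edge_vec e p a) (h *m edge_vec e p a) = 0.
Proof.
rewrite /vec_pairing big1// => i _; rewrite [(h *m _) _ _]mxE mulr_sumr big1//.
move=> j _; rewrite !mxE; have [->|ij] := eqVneq i j.
  by rewrite h_diag mul0r mulr0.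
by rewrite mulrCA -intrM edge_sign_mul// mulr0.
Qed.

(** Detailed balance holds: [lambda] times [trans] is the symmetric conductance, and reversing an
    edge inverts the connection, which replaces the operator of the edge by its adjoint. *)
Lemma twisted_trans_spectrum :
  exists d : 'I_#|{: X * 'cV['F_p]_r}| -> R,
    let M := twisted_trans e (trans C kappa) (Urep h) in
    (forall m, \tr (M ^+ m) = (\sum_i d i ^+ m)%:C%C) /\
    \det (1%:M - M) = (\prod_i (1 - d i))%:C%C.
Proof.
apply: (@reversible_spectrum _ _ _
  (fun a => lambda C kappa (enum_val a).1)) => [a|a b]; first exact: lambda_gt0.
have lamP x y : lambda C kappa x * trans C kappa x y = C x y.
  by rewrite /trans mulrC divfK// gt_eqF.
rewrite -[a]enum_valK -[b]enum_valK !enum_rankK.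
case: (enum_val a) (enum_val b) => x k [y k'] /=.
rewrite !twisted_transE// !conjcM conjc_nat conjc_real root_charJ.
rewrite mulrA -rmorphM /= [RHS]mulrA -rmorphM /=.
rewrite !lamP C_sym; apply: congr1.
rewrite -[(y, x)]/(opp_edge (x, y)) edge_vec_opp.
set v := edge_vec e p (x, y).
rewrite mulmxN opprK [k' + _ == k]eq_sym -subr_eq.
have [<-|_] := eqVneq (k - h *m v) k'; last by rewrite !mulr0.
by rewrite vec_pairingNl opprK vec_pairingBr edge_vec_isotropic subr0.
Qed.

End TwistedSpectrum.

(** * The logarithm series with an explicit remainder *)

Section LogSeries.
Variable R : realType.
Implicit Types x t : R.

Lemma is_derive_log_partial x N t : is_derive t 1
  (fun t => \sum_(n < N) (t * x) ^+ n.+1 / n.+1%:R)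
  (x * \sum_(n < N) (t * x) ^+ n).
Proof.
elim: N => [|N IH].
  rewrite big_ord0 mulr0.
  rewrite (_ : (fun _ => _) = cst 0); last by apply/funext => u; rewrite big_ord0.
  exact: is_derive_cst.
rewrite big_ord_recr /= mulrDr.
rewrite (_ : (fun _ => _) = (fun t => \sum_(n < N) (t * x) ^+ n.+1 / n.+1%:R)
  + (fun t => (t * x) ^+ N.+1 / N.+1%:R)); last first.
  by apply/funext => u; rewrite big_ord_recr.
apply: is_deriveD.
have dx : is_derive t 1 (fun t : R => t * x) x.
  rewrite (_ : (fun _ => _) = x \*: id); last first.
    by apply/funext => u /=; rewrite mulrC.
  by apply: is_derive_eq; rewrite /= -[RHS]mulr1.
rewrite (_ : (fun _ => _) =
    N.+1%:R^-1 \*: ((fun t : R => t * x) ^+ N.+1)); last first.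
  by rewrite exprfctE; apply/funext => u /=; rewrite mulrC.
apply: is_derive_eq; rewrite /= /GRing.scale /= !mulrA mulVf ?pnatr_eq0// mul1r.
by rewrite mulrC.
Qed.

(** Mean value theorem on [0, 1] for [f], which vanishes at 0: the geometric sum collapses its
    derivative to - x (t x)^N / (1 - t x). Both signs of [x] are treated at once. *)
Lemma ln_partial_bound x N : `|x| < 1 ->
  `|ln (1 - x) + \sum_(n < N) x ^+ n.+1 / n.+1%:R| <= `|x| ^+ N / (1 - `|x|).
Proof.
move=> x1; pose f t := ln (1 - t * x) + \sum_(n < N) (t * x) ^+ n.+1 / n.+1%:R.
pose df t := (1 - t * x)^-1 * - x + x * \sum_(n < N) (t * x) ^+ n.
have tx t : t \in `[0, 1] -> `|t * x| <= `|x|.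
  rewrite in_itv /= => /andP[t0 t1]; rewrite normrM ger0_norm//.
  by rewrite ler_piMl.
have tx1 t : t \in `[0, 1] -> 0 < 1 - t * x.
  move=> /tx txt; rewrite subr_gt0 (le_lt_trans (ler_norm _))//.
  exact: le_lt_trans x1.
have fd t : t \in `[0, 1] -> is_derive t 1 f (df t).
  move=> t01; apply: is_deriveD; last exact: is_derive_log_partial.
  rewrite -/(@ln R \o (fun t => 1 - t * x)).
  apply: is_derive1_comp; first exact/is_derive1_ln/tx1.
  rewrite (_ : (fun _ => _) = cst 1 - (x \*: id)); last first.
    by apply/funext => u /=; rewrite !fctE mulrC.
  apply: is_derive_eq; by rewrite sub0r /GRing.scale /= mulr1.
have fd' t : t \in `]0, 1[ -> is_derive t 1 f (df t).
  by move=> /subset_itv_oo_cc; exact: fd.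
have fc : {within `[0, 1], continuous f}.
  apply: continuous_in_subspaceT => t /set_mem t01.
  apply: differentiable_continuous; apply/derivable1_diffP.
  by have [] := fd _ t01.
have [c c01] := MVT_segment ler01 fd' fc.
rewrite subr0 mulr1 /f mul1r mul0r subr0 ln1 add0r.
rewrite [X in _ - X]big1 ?subr0; last first.
  by move=> n _; rewrite expr0n mul0r.
move=> ->; rewrite /df.
have -> : (1 - c * x)^-1 * - x + x * \sum_(n < N) (c * x) ^+ n
    = - x * (c * x) ^+ N / (1 - c * x).
  have := subrX1 (c * x) N; have := tx1 _ c01.
  move: (\sum_(_ < _) _) ((c * x) ^+ N) => s y.
  move=> c0 yE; have -> : y = 1 + (c * x - 1) * s by rewrite -yE addrC subrK.
  by field; rewrite gt_eqF.
rewrite !normrM normrN normrV ?unitfE ?gt_eqF ?tx1// normrX.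
rewrite ler_pM ?invr_ge0 ?mulr_ge0 ?exprn_ge0//.
  rewrite -[leRHS]mul1r ler_pM ?exprn_ge0 ?(ltW x1)//.
  by rewrite lerXn2r ?nnegrE// tx.
rewrite lef_pV2 ?posrE ?normr_gt0 ?gt_eqF ?tx1 ?subr_gt0//.
rewrite gtr0_norm ?tx1// lerD2l lerN2 (le_trans (ler_norm _))//.
exact: tx.
Qed.

Lemma cvg_ln_series x : `|x| < 1 ->
  series (fun n => x ^+ n.+1 / n.+1%:R) @ \oo --> - ln (1 - x).
Proof.
move=> x1; apply/cvgrPdist_le => eps eps0.
have : (fun N => `|x| ^+ N / (1 - `|x|)) @ \oo --> 0.
  rewrite -(mul0r (1 - `|x|)^-1); apply: cvgMl.
  by apply: cvg_expr; rewrite normr_id.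
move=> /cvgrPdist_le/(_ _ eps0); apply: filterS => N.
rewrite sub0r normrN => le_eps.
rewrite -normrN opprD !opprK seriesEord /=.
by rewrite (le_trans (ln_partial_bound _ x1))// (le_trans (ler_norm _)).
Qed.

End LogSeries.

(** * Exchange of limit and sum under domination *)

Section Tannery.
Variable R : realType.
Implicit Types g t : nat -> R.

Lemma series_tail_bound g t S T N : (forall n, `|g n| <= t n) ->
  series g @ \oo --> S -> series t @ \oo --> T ->
  `|S - series g N| <= T - series t N.
Proof.
move=> gt gS tT; apply: (@ler_cvg_to _ \oo _ _
    (fun M => `|series g M - series g N|) (fun M => series t M - series t N)).
- by apply: cvg_norm; apply: cvgB => //; exact: cvg_cst.
- by apply: cvgB => //; exact: cvg_cst.
near=> M; have NM : (N <= M)%N by near: M; exact: nbhs_infty_ge.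
rewrite !sub_series_geq// (le_trans (ler_norm_sum _ _ _))//.
exact: ler_sum.
Unshelve. all: by end_near. Qed.

Lemma dominated_series_cvg g t : (forall n, `|g n| <= t n) ->
  cvgn (series t) -> cvgn (series g).
Proof.
move=> gt ct; apply: normed_cvg.
apply: (@series_le_cvg _ (fun n => `|g n|) t _ _ gt ct) => n //.
exact: le_trans (normr_ge0 _) (gt n).
Qed.

(** Tannery's theorem along a proper filter, to be applied to [odd_primes]. The cut-off N depends on
    the tail of the majorant alone; the two tails and the difference of the partial sums each cost
    eps / 3. *)
Lemma tannery (F : set_system nat) (FF : ProperFilter F)
    (g : nat -> nat -> R) (g' t : nat -> R) (S : nat -> R) :
  (\forall p \near F, forall n, `|g p n| <= t n) ->
  (\forall p \near F, series (g p) @ \oo --> S p) ->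
  cvgn (series t) ->
  (forall n, g p n @[p --> F] --> g' n) ->
  (forall n, `|g' n| <= t n) /\ S @ F --> limn (series g').
Proof.
move=> gt gS ct gg'.
have g't n : `|g' n| <= t n.
  apply: (@closed_cvg _ _ F _ (fun p => `|g p n|) (fun x => x <= t n)).
  - exact: closed_le.
  - by apply: filterS gt.
  - exact: cvg_norm (gg' n).
split=> //; have cg' := dominated_series_cvg g't ct.
have partial N : series (g p) N @[p --> F] --> series g' N.
  elim: N => [|N IH].
    rewrite seriesEnat /= big_nil.
    under eq_fun do rewrite seriesEnat /= big_nil.
    exact: cvg_cst.
  rewrite seriesSr; under eq_fun do rewrite seriesSr.
  exact: cvgD.
apply/cvgrPdist_le => eps eps0.
have eps3 : 0 < eps / 3 by rewrite divr_gt0.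
have [N _ /(_ N (leqnn N)) tN] : \forall N \near \oo,
    limn (series t) - series t N <= eps / 3.
  have /cvgrPdist_le/(_ _ eps3) := ct; apply: filterS => N.
  exact/le_trans/ler_norm.
have /cvgrPdist_le/(_ _ eps3) pN := partial N.
near=> p.
have -> : limn (series g') - S p = (limn (series g') - series g' N)
    + (series g' N - series (g p) N) - (S p - series (g p) N) by ring.
have -> : eps = eps / 3 + eps / 3 + eps / 3 by field.
rewrite (le_trans (ler_normB _ _))// lerD//.
  rewrite (le_trans (ler_normD _ _))// lerD//.
    exact: le_trans (series_tail_bound N g't cg' ct) tN.
  by near: p.
apply: le_trans (series_tail_bound N _ _ ct) tN; by near: p.
Unshelve. all: by end_near. Qed.

End Tannery.

(** * Summability of the closed-walk weights *)

Section Substochastic.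
Variables (R : realType) (X : finType) (E : rel X).
Variables (C : X -> X -> R) (kappa : X -> R).
Hypothesis E_conn : connected_graph E.
Hypothesis E_cond : conductances E C.
Hypothesis kappa_kill : killing kappa.

Local Notation P := (trans C kappa).

Lemma conductance_ge0 x y : 0 <= C x y.
Proof.
have [_ C_gt0 C0] := E_cond; have [/C_gt0/ltW//|/C0 ->//] := boolP (E x y).
Qed.

Lemma lambda_gt0 x : 0 < lambda C kappa x.
Proof.
have [k_ge0 [z kz]] := kappa_kill; have [_ C_gt0 _] := E_cond.
have sum_ge0 : 0 <= \sum_y C x y by apply: sumr_ge0 => y _; exact: conductance_ge0.
have [->|xz] := eqVneq x z.
  rewrite /lambda ltr_pwDl//; first by rewrite lt_neqAle eq_sym kz k_ge0.
  by apply: sumr_ge0 => y _; exact: conductance_ge0.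
have /connectP[[|y s]] := E_conn x z.
  by move=> _ /eqP; rewrite eq_sym (negbTE xz).
move=> /= /andP[xy _] _; rewrite ltr_wpDl// (bigD1 y)//= ltr_pwDl ?C_gt0//.
by apply: sumr_ge0 => u _; exact: conductance_ge0.
Qed.

Lemma trans_ge0 x y : 0 <= P x y.
Proof. by rewrite divr_ge0 ?conductance_ge0// ltW// lambda_gt0. Qed.

Lemma sum_trans x : \sum_y P x y = 1 - kappa x / lambda C kappa x.
Proof.
rewrite -mulr_suml; apply/eqP; rewrite -subr_eq0 opprB addrA -mulrDl.
by rewrite [_ + kappa x]addrC divff ?subrr// gt_eqF// lambda_gt0.
Qed.

(** P^n applied to the constant 1: the probability that the killed chain started at x is alive after
    n steps. *)
Fixpoint survival n x : R :=
  if n is n'.+1 then \sum_y P x y * survival n' y else 1.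

Lemma survivalE n x : survival n.+1 x = \sum_y P x y * survival n y.
Proof. by []. Qed.

Lemma survivalS n x : survival n.+1 x <= survival n x.
Proof.
elim: n x => [|n IH] x /=.
  under eq_bigr do rewrite mulr1.
  rewrite sum_trans gerBl divr_ge0 ?(ltW (lambda_gt0 _))//.
  by have [] := kappa_kill.
by apply: ler_sum => y _; rewrite ler_wpM2l ?trans_ge0// IH.
Qed.

Lemma survival_le n m x : (n <= m)%N -> survival m x <= survival n x.
Proof.
move=> /subnK <-; elim: (m - n)%N => //= k IH.
exact: le_trans (survivalS _ _) IH.
Qed.

Lemma survival_le1 n x : survival n x <= 1.
Proof. exact: (@survival_le 0). Qed.

(** From each vertex some path of positive probability leads to a vertex with positive killing rate.
    A common N exists because X is finite and survival decreases in time. *)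
Lemma survival_lt1 : exists N, forall x, survival N x < 1.
Proof.
have [k_ge0 [z kz]] := kappa_kill; have [_ C_gt0 _] := E_cond.
have each x : exists n, survival n x < 1.
  (* One step more than the path has, for the killing at [z] itself. *)
  have /connectP[s xs zE] := E_conn x z; exists (size s).+1.
  elim: s x xs zE => [x _ /= zx|y s IH x xys zE].
    rewrite -zx; under eq_bigr do rewrite mulr1.
    rewrite sum_trans gtrBl divr_gt0 ?lambda_gt0//.
    by rewrite lt_neqAle eq_sym kz k_ge0.
  have /andP[xy ys] : E x y && path E y s by [].
  have IHy := IH y ys zE; rewrite survivalE.
  have P1 : \sum_u P x u <= 1.
    by rewrite sum_trans gerBl divr_ge0 ?(ltW (lambda_gt0 _)).
  apply: lt_le_trans P1; rewrite (bigD1 y)//= [ltRHS](bigD1 y)//=.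
  rewrite ltr_leD//.
    by rewrite gtr_pMr// divr_gt0 ?C_gt0 ?lambda_gt0.
  by apply: ler_sum => u _; rewrite ler_piMr ?trans_ge0// -survivalE survival_le1.
have [n nP] := choice each; exists (\max_x n x)%N => x.
by apply: le_lt_trans (nP x); apply: survival_le; exact: leq_bigmax.
Qed.

(** M steps multiply survival by at most c < 1, so a bound B for shorter sums gives M + c B for
    longer ones. The constant M / (1 - c) is the fixed point of this operation, hence is preserved
    by strong induction on N. *)
Lemma sum_survival_bounded : exists B, forall N x,
  \sum_(n < N) survival n x <= B.
Proof.
have [M M1] := survival_lt1.
pose c := \big[Num.max/0]_x survival M x.
have c1 : c < 1 by apply: bigmax_lt => // x _; exact: M1.
have cM x : survival M x <= c by exact: le_bigmax.
have c0 : 0 <= c by exact: bigmax_ge_id.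
have S_add n j x : survival (n + j) x =
    iter n (fun f x => \sum_y P x y * f y) (survival j) x.
  by elim: n x => //= n IH x; apply: eq_bigr => y _; rewrite IH.
have iter_sum n (f : nat -> X -> R) k x :
    \sum_(j < k) iter n (fun f x => \sum_y P x y * f y) (f j) x =
    iter n (fun f x => \sum_y P x y * f y) (fun y => \sum_(j < k) f j y) x.
  elim: n x => //= n IH x; rewrite exchange_big /=; apply: eq_bigr => y _.
  by rewrite -mulr_sumr IH.
have iter_le n (f : X -> R) B x : (forall y, f y <= B) ->
    iter n (fun f x => \sum_y P x y * f y) f x <= B * survival n x.
  move=> fB; elim: n x => [|n IH] x /=; first by rewrite mulr1.
  by rewrite mulr_sumr; apply: ler_sum => y _; rewrite mulrCA ler_wpM2l ?trans_ge0.
exists (M%:R / (1 - c)) => N; set B := _ / _.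
have B0 : 0 <= B by rewrite divr_ge0 ?subr_ge0 ?(ltW c1).
have MB : M%:R + c * B = B by rewrite /B; field; rewrite subr_eq0 eq_sym lt_eqF.
have first k x : \sum_(n < k) survival n x <= k%:R.
  have -> : k%:R = \sum_(n < k) (1 : R) by rewrite sumr_const card_ord.
  by apply: ler_sum => n _; exact: survival_le1.
have [n] := ubnP N; elim: n N => // n IH N Nn x.
have [NM|MN] := leqP N M.
  rewrite -MB; apply: le_trans (first N x) _; apply: ler_wpDr.
    exact: mulr_ge0.
  by rewrite ler_nat.
have [M0|M_gt0] := posnP M.
  by have := M1 x; rewrite M0 /= ltxx.
rewrite -(subnKC (ltnW MN)) big_split_ord /= -MB lerD ?first//.
under eq_bigr do rewrite S_add.
rewrite iter_sum (le_trans (iter_le _ _ B _ _))//; last first.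
  by rewrite mulrC ler_wpM2r.
by move=> y; apply: IH; rewrite -ltnS; apply: leq_trans Nn;
  rewrite ltnS ltn_subrL M_gt0 (leq_trans _ MN).
Qed.

(** The trace of the power n+1 of the transition matrix, as a sum over closed walks. It serves as
    the majorant uniform in p and u; being summable already, it omits the factor 1 / (n+1). *)
Definition loop_mass n : R :=
  \sum_(s : n.+1.-tuple X) \prod_(a <- steps s) P a.1 a.2.

Lemma steps_weight_ge0 (s : seq X) : 0 <= \prod_(a <- steps s) P a.1 a.2.
Proof. by apply: prodr_ge0 => a _; exact: trans_ge0. Qed.

Lemma loop_mass_ge0 n : 0 <= loop_mass n.
Proof. by apply: sumr_ge0 => s _; exact: steps_weight_ge0. Qed.

(** Forgetting the return to the starting vertex can only increase the total weight. *)
Lemma loop_mass_le n : loop_mass n <= \sum_x survival n.+1 x.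
Proof.
rewrite /loop_mass big_tuple_cons; apply: ler_sum => x _.
under eq_bigr do rewrite steps_cons.
(* The return vertex is separated from the starting vertex, since only the latter moves in the
   induction. *)
move: {2}x => y; elim: n x => [|n IH] x.
  rewrite (bigD1 [tuple])//= [X in _ + X]big1 ?addr0; last first.
    by move=> t /eqP; rewrite tuple0.
  rewrite big_seq1 /=; under eq_bigr do rewrite mulr1.
  by rewrite (bigD1 y)//= ler_wpDr// sumr_ge0// => z _; exact: trans_ge0.
rewrite big_tuple_cons survivalE; apply: ler_sum => z _.
under eq_bigr do rewrite /= big_cons /=.
by rewrite -mulr_sumr ler_wpM2l ?trans_ge0// IH.
Qed.

Lemma cvg_loop_mass : cvgn (series loop_mass).
Proof.
have [B SB] := sum_survival_bounded.
apply: nondecreasing_is_cvgn.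
  by apply: nondecreasing_series => n _ _; exact: loop_mass_ge0.
exists (\sum_(x : X) B) => _ [N _ <-]; rewrite seriesEord /=.
rewrite (@le_trans _ _ (\sum_(n < N) \sum_x survival n.+1 x))//.
  by apply: ler_sum => n _; exact: loop_mass_le.
rewrite exchange_big /=; apply: ler_sum => x _.
apply: le_trans (SB N.+1 x); rewrite big_ord_recl /= ler_wpDl//.
Qed.

End Substochastic.

(** * Rotations, periods and multiplicity of words *)

Section Rotations.
Variable T : eqType.
Implicit Types (s t u : seq T).

Lemma commuting_word_pow t u j : t ++ u = u ++ t -> size u = (j * size t)%N ->
  u = flatten (nseq j t).
Proof.
elim: j u => [|j IH] u tu; first by rewrite mul0n => /eqP/nilP.
rewrite mulSn => su; have tE : take (size t) u = t.
  have := congr1 (take (size t)) tu.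
  by rewrite take_size_cat// takel_cat// su leq_addr.
move: tu su; rewrite -[u](cat_take_drop (size t)) tE; move: (drop _ _) => v.
rewrite -catA => /eqP; rewrite eqseq_cat// eqxx /= => /eqP tv.
rewrite size_cat => /eqP; rewrite eqn_add2l => /eqP sv.
by rewrite -(IH v tv sv).
Qed.

Lemma rot_mul_period s d q : rot d s = s -> (q * d <= size s)%N ->
  rot (q * d) s = s.
Proof.
move=> sd; elim: q => [|q IH] qs; first by rewrite mul0n rot0.
by rewrite mulSn rotD -?mulSn// IH// (leq_trans _ qs)// leq_mul2r leqnSn orbT.
Qed.

(** When m divides the size, the rotation fixes [s] exactly when the prefix commutes with the rest
    of the word, which is then a power of the prefix. *)
Lemma period_powE s m : (0 < m)%N -> s <> [::] ->
  (s == flatten (nseq m (take (size s %/ m) s))) =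
  (m %| size s)%N && (rot (size s %/ m) s == s).
Proof.
move=> m0 s0; apply/eqP/andP => [sE|[ms /eqP rs]].
  have st : size (take (size s %/ m) s) = (size s %/ m)%N.
    by rewrite size_takel// leq_div.
  have sm : size s = (m * (size s %/ m))%N.
    by rewrite {1}sE size_flatten /shape map_nseq sumn_nseq st mulnC.
  split; first by rewrite sm dvdn_mulr.
  apply/eqP; move: st sE; move: (take _ _) => t <- sE; rewrite sE.
  case: m m0 {sm sE} => // m _ /=; rewrite rot_size_cat.
  by elim: m => [|m IH] /=; rewrite ?cats0// -catA IH.
case: m m0 ms rs => // m _ ms rs; rewrite /= -{1}[s](cat_take_drop (size s %/ m.+1)).
congr (_ ++ _); apply: commuting_word_pow.
  by rewrite cat_take_drop -[LHS]rs.
by rewrite size_drop size_takel ?leq_div// -{1}(divnK ms) mulnS addKn mulnC.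
Qed.

(** The least period divides the size because the remainder of the division, if positive, would be a
    smaller period. *)
Lemma min_periodP s : s <> [::] ->
  exists d, [/\ (0 < d)%N, (d %| size s)%N, rot d s = s &
    forall k, (0 < k)%N -> rot k s = s -> (d <= k)%N].
Proof.
move=> s0; have n0 : (0 < size s)%N by case: (s) s0.
have ex : exists k, (0 < k)%N && (rot k s == s).
  by exists (size s); rewrite n0 rot_size eqxx.
case: (ex_minnP ex) => d /andP[d0 /eqP sd] dmin; exists d.
have dm k : (0 < k)%N -> rot k s = s -> (d <= k)%N.
  by move=> k0 sk; apply: dmin; rewrite k0 sk eqxx.
split=> //; rewrite /dvdn; apply: contraT; rewrite -lt0n => r0.
suff rs : rot (size s %% d) s = s by have := dm _ r0 rs; rewrite leqNgt ltn_mod d0.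
have nE : (size s %% d + size s %/ d * d = size s)%N by rewrite addnC -divn_eq.
have := @rotD _ (size s %% d) (size s %/ d * d) s; rewrite nE leqnn rot_size.
by rewrite (rot_mul_period sd (leq_trunc_div _ _)) => /(_ isT)/esym.
Qed.

End Rotations.

(** By [period_powE] an admissible exponent m corresponds to the period [size s %/ m]; the largest
    exponent comes from the least period. *)
Lemma multiplicity_period (X : finType) (s : seq X) d : s <> [::] ->
  (0 < d)%N -> (d %| size s)%N -> rot d s = s ->
  (forall k, (0 < k)%N -> rot k s = s -> (d <= k)%N) ->
  (multiplicity s * d = size s)%N.
Proof.
move=> s0 d0 ds sd dmin; have n0 : (0 < size s)%N by case: (s) s0.
suff -> : multiplicity s = (size s %/ d)%N by rewrite divnK.
have nd0 : (0 < size s %/ d)%N by rewrite divn_gt0// dvdn_leq.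
apply/eqP; rewrite eqn_leq; apply/andP; split.
  apply/bigmax_leqP => -[m mn].
  change (s == flatten (nseq m (take (size s %/ m) s)) -> (m <= size s %/ d)%N).
  case: m mn => // m mn; rewrite period_powE// => /andP[ms /eqP rs].
  rewrite leq_divRL//.
  rewrite -[leqRHS](divnK ms) mulnC leq_mul2r /=; apply: dmin => //.
  by rewrite divn_gt0// dvdn_leq.
have lt_nd : (size s %/ d < (size s).+1)%N by rewrite ltnS leq_div.
rewrite /multiplicity.
have := @leq_bigmax_cond _ (fun m : 'I_(size s).+1 =>
   s == flatten (nseq m (take (size s %/ m) s))) (fun m => nat_of_ord m)
   (Ordinal lt_nd); apply.
rewrite /= period_powE// dvdn_div//=.
suff -> : (size s %/ (size s %/ d) = d)%N by rewrite sd.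
by rewrite -{1}(divnK ds) mulKn.
Qed.

Lemma esum_finType (R : realType) (T : finType) (P : pred T)
    (f : T -> \bar R) : (forall i, 0 <= f i)%E ->
  \esum_(i in [set i | P i]) f i = (\sum_(i | P i) f i)%E.
Proof.
move=> f0; rewrite esum_fset//; last exact: finite_finset.
rewrite (_ : [set i | P i] = [set` enum P]); last first.
  by apply/seteqP; split=> i /=; rewrite mem_enum.
by rewrite -fsbig_seq ?enum_uniq//= big_enum.
Qed.

(** * Sums over loops as sums over based loops *)

Section LoopSums.
Variables (R : realType) (X : finType) (E : rel X).
Implicit Types (l : loop E) (s : based_loop E).

Lemma based_loop_neq0 s : val s <> [::].
Proof. by case: s => -[]. Qed.

Lemma is_based_loop_rot k s : is_based_loop E (rot k (val s)).
Proof.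
case: s => s /= /andP[s0 cs]; rewrite /is_based_loop rot_cycle cs andbT.
by rewrite -size_eq0 size_rot size_eq0.
Qed.

Definition rot_based k s : based_loop E := Sub _ (is_based_loop_rot k s).

Lemma pi_rot_based k s : (\pi_(loop E) (rot_based k s) = \pi_(loop E) s)%qT.
Proof. by apply/esym/eqquotP/shift_equivP; exists k. Qed.

Lemma pi_eq_rot s l : (\pi_(loop E) s = l)%qT ->
  exists2 k, (k <= size (based_at l))%N & val s = rot k (based_at l).
Proof.
move=> sl; have : shift_equivalence E (repr l) s.
  by apply/(@eqquotP _ _ (loop E)); rewrite reprK.
by move=> /existsP[k /eqP ->]; exists k => //; rewrite -ltnS.
Qed.

Variable w : seq X -> R.
Hypothesis w_ge0 : forall s : seq X, 0 <= w s.
Hypothesis w_rot : forall k (s : seq X), w (rot k s) = w s.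
Hypothesis w_supp : forall s : seq X, s <> [::] -> ~~ cycle E s -> w s = 0.

(* The loop l has size / mult(l) based representatives. *)
Lemma esum_fiber l :
  \esum_(s in [set s : based_loop E | (\pi_(loop E) s = l)%qT])
    (w (val s) / (size (val s))%:R)%:E =
  ((multiplicity (based_at l))%:R^-1 * w (based_at l))%:E.
Proof.
have s0 : based_at l <> [::] by exact: based_loop_neq0.
have n0 : (0 < size (based_at l))%N by case: (based_at l) s0.
have [d [d0 ds sd dmin]] := min_periodP s0.
have md := multiplicity_period s0 d0 ds sd dmin.
(* The rotations by k < d enumerate the fibre without repetition, since d is the least period. *)
rewrite (reindex_esum [set: 'I_d] _ (fun k : 'I_d => rot_based k (repr l))).
- under eq_esum => k _ do rewrite /= w_rot size_rot.
  rewrite (_ : [set: 'I_d] = [set k : 'I_d | xpredT k]); last first.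
    by apply/seteqP; split.
  rewrite esum_finType//.
    rewrite sumEFin sumr_const card_ord -/(based_at l) -md; congr (_%:E).
    have m0 : (multiplicity (based_at l))%:R != 0 :> R.
      by rewrite pnatr_eq0 -lt0n; move: n0; rewrite -md muln_gt0 => /andP[].
    have d0' : d%:R != 0 :> R by rewrite pnatr_eq0 -lt0n.
    by rewrite -mulr_natl natrM; field; rewrite m0 d0'.
  by move=> k; rewrite lee_fin divr_ge0.
split.
- by move=> k _ /=; rewrite pi_rot_based reprK.
- move=> i j _ _ /(congr1 val) /=; rewrite -/(based_at l).
  wlog ij : i j / (i <= j)%N => [th|].
    have [/th//|/ltnW ji eij] := leqP i j; exact/esym/th.
  have jn : (j <= size (based_at l))%N.
    by rewrite (leq_trans (ltnW (ltn_ord j)))// dvdn_leq.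
  rewrite -{1}(subnKC ij) rotD ?subnKC// => /rot_inj /esym sji.
  apply/val_inj/eqP; rewrite /= eqn_leq ij /= -subn_eq0.
  apply: contraT; rewrite -lt0n => ji0; have := dmin _ ji0 sji.
  by rewrite leqNgt (leq_ltn_trans (leq_subr _ _)).
- move=> s /= /pi_eq_rot[k kn sk].
  exists (Ordinal (ltn_pmod k d0)) => //; apply/val_inj; rewrite /= sk.
  rewrite -/(based_at l) [in RHS](divn_eq k d) [in RHS]addnC rotD.
    rewrite rot_mul_period//; apply: leq_trans kn; exact: leq_trunc_div.
  by rewrite addnC -divn_eq.
Qed.

(** [esum_fiber] spreads the weight of a loop over its based representatives, each receiving [w]
    divided by the length. These are regrouped by length; tuples that are not cycles may be added
    because [w] vanishes on them. *)
Lemma esum_loops (Q : pred (seq X)) : (forall k (s : seq X), Q (rot k s) = Q s) ->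
  \esum_(l in [set l : loop E | Q (based_at l)])
    ((multiplicity (based_at l))%:R^-1 * w (based_at l))%:E =
  (\sum_(0 <= n <oo)
    ((\sum_(s : n.+1.-tuple X | Q s) w s) / n.+1%:R)%:E)%E.
Proof.
move=> Qrot; under eq_esum do rewrite -esum_fiber.
set a := fun s : based_loop E => (w (val s) / (size (val s))%:R)%:E.
have a0 s : (0 <= a s)%E by rewrite lee_fin divr_ge0.
rewrite (esum_esum (a := fun _ s => a s))//.
(* A pair (loop, representative) is determined by the representative. *)
rewrite (reindex_esum [set s : based_loop E | Q (val s)] _
    (fun s => (\pi_(loop E) s, s)%qT)); last first.
  split=> [s /= Qs|s t _ _ [_ ->]//|[l s] /= [Ql sl]].
    by split=> //=; have [k _ sk] := pi_eq_rot (erefl (\pi_(loop E) s)%qT);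
      rewrite -(Qrot k) -sk.
  exists s; last by rewrite sl.
  by have [k _ ->] := pi_eq_rot sl; rewrite Qrot.
rewrite [X in \esum_(_ in X) _](_ : _ = \bigcup_n
    [set s : based_loop E | Q (val s) /\ size (val s) = n.+1]); last first.
  apply/seteqP; split=> [s /= Qs|s [n _ /= []]//].
  exists (size (val s)).-1 => //; split=> //; rewrite prednK//.
  by case: (val s) (@based_loop_neq0 s).
rewrite nneseries_sum_bigcup//; last first.
  apply/trivIsetP => i j _ _ ij; apply/seteqP; split=> // s [[_ /= si] [_ sj]].
  by move: ij; rewrite -eqSS -si -sj eqxx.
apply: eq_eseriesr => n _.
rewrite mulr_suml -sumEFin big_mkcond /=.
pose ok (t : n.+1.-tuple X) := Q t && cycle E t.
rewrite (_ : \sum_t _ = \sum_(t | ok t) (w t / n.+1%:R)%:E)%E; last first.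
  rewrite [RHS]big_mkcond /=; apply: eq_bigr => t _; rewrite /ok.
  have [_|//] := boolP (Q t); have [//|/w_supp ->] := boolP (cycle E t).
    by rewrite mul0r.
  by case: t => -[].
rewrite -esum_finType; last by move=> t; rewrite lee_fin divr_ge0.
pose B := [set u : seq X | [/\ Q u, cycle E u & size u = n.+1]].
transitivity (\esum_(u in B) (w u / (size u)%:R)%:E).
  apply/esym/(@reindex_esum _ _ _ _ B (fun s : based_loop E => val s)
    (fun u => (w u / (size u)%:R)%:E)).
  split=> [[s /= /andP[_ cs]] [Qs sn]|s t _ _ /val_inj//|u [Qu cu un]] //.
  have bu : is_based_loop E u by rewrite /is_based_loop cu -size_eq0 un.
  by exists (exist _ u bu).
rewrite (@reindex_esum _ _ _ [set t : n.+1.-tuple X | ok t] B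
    (fun t : n.+1.-tuple X => tval t) (fun u => (w u / (size u)%:R)%:E)).
  by apply: eq_esum => t _; rewrite size_tuple.
split=> [t /andP[Qt ct]|s t _ _ /val_inj//|u [Qu cu un]].
  by split; rewrite ?size_tuple.
have uS : size u == n.+1 by apply/eqP.
by exists (Tuple uS) => //=; rewrite /ok Qu.
Qed.

End LoopSums.

(** * Trigonometric integrals on the unit cube *)

Section UnitCube.
Variable R : realType.
Local Notation leb := (lebesgue_tuple R).
Local Notation cube := (unit_cube R).

Lemma measurable_unit_cube n : measurable (cube n).
Proof.
rewrite (_ : cube n = \bigcap_(k in [set: 'I_n])
    ((fun u : n.-tuple R => tnth u k) @^-1` `[0, 1])); last first.
  apply/seteqP; split=> [u cu k _|u cu k] /=; first by rewrite in_itv; exact: cu.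
  by have := cu k I; rewrite /= in_itv.
apply: fin_bigcap_measurable => // k _; rewrite -[X in measurable X]setTI.
exact: measurable_tnth.
Qed.

Lemma tcons_unit_cube n :
  @tcons R n @^-1` cube n.+1 = `[0, 1]%classic `*` cube n.
Proof.
apply/seteqP; split=> [[x t] /= ct|[x t] /= [x01 ct] k].
  split=> [|k] /=; first by have := ct ord0; rewrite in_itv.
  by have := ct (lift ord0 k); rewrite tnthS.
case: (unliftP ord0 k) => [j ->|->]; first by rewrite tnthS.
by move: x01; rewrite /= in_itv.
Qed.

Lemma lebesgue_itv01 : lebesgue_measure (`[0, 1]%classic : set R) = 1%E.
Proof. by rewrite lebesgue_measure_itv /= lte_fin ltr01 oppr0 adde0. Qed.

Lemma lebesgue_unit_cube n : leb n (cube n) = 1%E.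
Proof.
elim: n => [|n IH] /=.
  rewrite diracE mem_set//= => -[]//.
rewrite /lebesgue_cons /pushforward tcons_unit_cube product_measure1E//.
  transitivity (1 * 1 : \bar R)%E; last by rewrite mule1.
  congr (_ * _)%E; [exact: lebesgue_itv01|exact: IH].
exact: measurable_unit_cube.
Qed.

Lemma lebesgue_unit_cube_lty n : (leb n (cube n) < +oo)%E.
Proof. by rewrite lebesgue_unit_cube ltry. Qed.

Lemma bounded_integrable_cube n (f : n.-tuple R -> R) (B : R) :
  measurable_fun setT f -> (forall u, `|f u| <= B) ->
  (leb n).-integrable (cube n) (EFin \o f).
Proof.
move=> mf fB; apply: measurable_bounded_integrable.
- exact: measurable_unit_cube.
- exact: lebesgue_unit_cube_lty.
- exact: measurable_funTS.
- exists B; split; first exact: num_real.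
  by move=> M BM u _; exact: le_trans (fB u) (ltW BM).
Qed.

(** Fubini's theorem, [lebesgue_tuple] being by construction the image of a product measure; the
    bound [B] gives integrability on the product. *)
Lemma integral_unit_cubeS n (f : n.+1.-tuple R -> R) (B : R) :
  measurable_fun setT f -> (forall u, `|f u| <= B) ->
  (\int[leb n.+1]_(u in cube n.+1) (f u)%:E =
   \int[lebesgue_measure]_(x in `[0%R, 1%R])
     \int[leb n]_(t in cube n) (f (tcons (x, t)))%:E)%E.
Proof.
move=> mf fB.
have mc := @measurable_tcons R n.
have mI : measurable (`[0, 1]%classic `*` cube n : set (R * n.-tuple R)).
  by apply: measurableX => //; exact: measurable_unit_cube.
have intf : (@lebesgue_measure R \x leb n)%E.-integrable
    (@tcons R n @^-1` cube n.+1) ((EFin \o f) \o @tcons R n).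
  rewrite tcons_unit_cube.
  change ((@lebesgue_measure R \x leb n)%E.-integrable
    (`[0, 1]%classic `*` cube n) (EFin \o (f \o @tcons R n))).
  apply: measurable_bounded_integrable => //.
  - suff : ((@lebesgue_measure R \x leb n) (`[0%R, 1%R]%classic `*` cube n)
        < +oo)%E by [].
    rewrite product_measure1E//; last exact: measurable_unit_cube.
    apply: lte_mul_pinfty => //; last exact: lebesgue_unit_cube_lty.
    by have : lebesgue_measure (`[0, 1]%classic : set R) \is a fin_num
      by rewrite lebesgue_itv01.
  - by apply: measurable_funTS; exact: measurableT_comp.
  - exists B; split; first exact: num_real.
    by move=> M BM u _; exact: le_trans (fB _) (ltW BM).
transitivity (\int[pushforward (@lebesgue_measure R \x leb n)%E (@tcons R n)]_(u
    in cube n.+1) (EFin \o f) u)%E.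
  exact: eq_measure_integral.
rewrite integral_pushforward//; last 2 first.
- exact/measurable_EFinP.
- exact: measurable_unit_cube.
rewrite tcons_unit_cube in intf *.
rewrite integral_mkcond -integral12_prod_meas1; last first.
  refine ((integrable_mkcond _ _).1 intf).
  by apply: measurableX => //; exact: measurable_unit_cube.
rewrite [RHS]integral_mkcond; apply: eq_integral => x _; rewrite /fubini_F.
rewrite patchE; case: ifPn => [/set_mem x01|/negP x01].
  rewrite [RHS]integral_mkcond; apply: eq_integral => t _; rewrite !patchE.
  congr (if _ then _ else _).
  apply/idP/idP => [/set_mem[_ /=] /mem_set//|/set_mem ct].
  exact/mem_set.
apply: integral0_eq => t _; rewrite patchE; case: ifPn => // /set_mem[/= h _].
by exfalso; apply/x01/mem_set.
Qed.

Lemma sin_int_period (x : R) (z : int) : sin (x + 2 * pi * z%:~R) = sin x.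
Proof.
have nat_period (y : R) n : sin (y + 2 * pi * n%:R) = sin y.
  by have := cis_period y n => -[].
case: z => n; first exact: nat_period.
by rewrite -[LHS](nat_period _ n.+1) NegzE mulrNz mulrN subrK.
Qed.

Lemma integral_cos_int (z : int) (c : R) :
  (\int[lebesgue_measure]_(x in `[0%R, 1%R]) (cos (c + 2 * pi * z%:~R * x))%:E =
   (if z == 0 then cos c else 0)%:E)%E.
Proof.
have [->|z0] := eqVneq z 0.
  under eq_integral do rewrite mulr0 mul0r addr0.
  rewrite integral_cst//= -[RHS]mule1; congr (_ * _)%E; exact: lebesgue_itv01.
set b := 2 * pi * z%:~R.
have b0 : b != 0.
  by rewrite !mulf_neq0 ?intr_eq0// gt_eqF// pi_gt0.
have lin (x : R) : is_derive x 1 (fun x : R => c + b * x) b.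
  rewrite (_ : (fun _ => _) = cst c + (b \*: id)); last by apply/funext.
  by apply: is_derive_eq; rewrite add0r /GRing.scale /= mulr1.
pose F (x : R) := b^-1 * sin (c + b * x).
have dF (x : R) : is_derive x 1 F (cos (c + b * x)).
  rewrite (_ : F = b^-1 \*: (sin \o (fun x : R => c + b * x))); last by apply/funext.
  have ds := @is_derive1_comp R sin (fun x : R => c + b * x) x _ _
    (is_derive_sin _) (lin x).
  by apply: is_derive_eq; rewrite /GRing.scale /= mulrC mulfK.
have dcont (g : R -> R) (dg : R -> R) : (forall x : R, is_derive x 1 g (dg x)) ->
    continuous g.
  move=> gd x; apply: differentiable_continuous; apply/derivable1_diffP.
  by have [] := gd x.
rewrite (@continuous_FTC2 _ _ F)//.
- rewrite /F mulr1 mulr0 addr0 /b sin_int_period -EFinB subrr//.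
- apply: continuous_subspaceT => x; apply: continuous_comp.
    exact: (dcont _ (fun=> b)).
  exact: continuous_cos.
- split=> [x _||].
  + by have [] := dF x.
  + by apply: cvg_at_right_filter; exact: (dcont _ _ dF).
  + by apply: cvg_at_left_filter; exact: (dcont _ _ dF).
- by move=> x _; rewrite derive1E; exact: derive_val.
Qed.

Lemma measurable_phase n (b : 'I_n -> R) (c : R) :
  measurable_fun [set: n.-tuple R] (fun u => c + \sum_k b k * tnth u k).
Proof.
apply: measurable_funD => //; apply: measurable_sum => k.
by apply: measurable_funM => //; exact: measurable_tnth.
Qed.

Lemma measurable_cos_phase n (b : 'I_n -> R) (c : R) :
  measurable_fun [set: n.-tuple R] (fun u => cos (c + \sum_k b k * tnth u k)).
Proof.
apply: (measurableT_comp (f := @cos R)); last exact: measurable_phase.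
by apply: continuous_measurable_fun => x; exact: continuous_cos.
Qed.

(** The constant [c] makes the induction possible: it absorbs the first coordinate while the others
    are integrated. *)
Lemma integral_cube_cos n (z : 'I_n -> int) (c : R) :
  (\int[leb n]_(u in cube n)
     (cos (c + \sum_k 2 * pi * (z k)%:~R * tnth u k))%:E =
   (if [forall k, z k == 0] then cos c else 0)%:E)%E.
Proof.
elim: n z c => [|n IH] z c.
  rewrite /= integral_dirac//=; last 2 first.
  - exact: measurable_unit_cube.
  - exact: measurable_funTS (measurableT_comp _ (measurable_cos_phase _ _)).
  rewrite diracE mem_set//=; last by case.
  rewrite mul1e big_ord0 addr0 (_ : [forall k, _])//.
  by apply/forallP => -[].
rewrite (@integral_unit_cubeS _ _ 1); last 2 first.
- exact: measurable_cos_phase.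
- by move=> u; exact: cos_max.
transitivity (\int[lebesgue_measure]_(x in `[0%R, 1%R])
   (if [forall k : 'I_n, z (lift ord0 k) == 0%R]
    then cos (c + 2 * pi * (z ord0)%:~R * x) else 0)%:E)%E.
  apply: eq_integral => x _; rewrite -IH; apply: eq_integral => t _.
  rewrite big_ord_recl addrA; congr (cos (_ + _ + _))%:E.
  by apply: eq_bigr => k _; rewrite tnthS.
have -> : [forall k, z k == 0] =
    (z ord0 == 0) && [forall k : 'I_n, z (lift ord0 k) == 0].
  apply/forallP/andP => [z0|[z0 /forallP zl] k].
    by split=> //; apply/forallP.
  by case: (unliftP ord0 k) => [j ->|->].
have [zl|zl] := boolP [forall k : 'I_n, z (lift ord0 k) == 0].
  by rewrite integral_cos_int andbT.
by rewrite integral0 andbF.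
Qed.

(** Dominated convergence: the total sum of [t] is a constant that bounds all partial sums, and it
    is integrable because the cube has finite measure. *)
Lemma integral_cube_series n (g : nat -> n.-tuple R -> R) (t J : nat -> R) :
  (forall k, measurable_fun setT (g k)) -> (forall k u, `|g k u| <= t k) ->
  cvgn (series t) ->
  (forall k, \int[leb n]_(u in cube n) (g k u)%:E = (J k)%:E)%E ->
  (leb n).-integrable (cube n)
    (EFin \o (fun u => limn (series (fun k => g k u)))) /\
  \int[leb n]_(u in cube n) limn (series (fun k => g k u)) = limn (series J).
Proof.
move=> mg gt ct gJ.
have cg u := dominated_series_cvg (gt^~ u) ct.
pose fN N u := (series (fun k => g k u) N)%:E.
have mfN N : measurable_fun (cube n) (fN N).
  apply/measurable_EFinP; apply: measurable_funTS.
  exact: (measurable_sum (index_iota 0 N) (h := g)).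
have fNcvg u : fN^~ u @ \oo --> (limn (series (fun k => g k u)))%:E.
  by apply: cvg_EFin; [exact: nearW|exact: cg].
have mlim : measurable_fun (cube n)
    (EFin \o (fun u => limn (series (fun k => g k u)))).
  by apply: (emeasurable_fun_cvg fN) => // u _; exact: fNcvg.
have iT : (leb n).-integrable (cube n) (fun=> (limn (series t))%:E).
  exact: (@bounded_integrable_cube _ (fun=> limn (series t))
    `|limn (series t)|).
have fNae : {ae leb n, forall u, cube n u ->
    fN^~ u @ \oo --> (limn (series (fun k => g k u)))%:E}.
  by apply: aeW => u _; exact: fNcvg.
have fNt : {ae leb n, forall u N, cube n u ->
    (`|fN N u| <= (limn (series t))%:E)%E}.
  apply: aeW => u N _; rewrite lee_fin.
  have nd : nondecreasing_seq (series t).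
    apply: nondecreasing_series => k _ _.
    exact: le_trans (normr_ge0 _) (gt k u).
  apply: le_trans (nondecreasing_cvgn_le nd ct N).
  by rewrite (le_trans (ler_norm_sum _ _ _))//; apply: ler_sum.
have [ilim _ fNint] := dominated_convergence (@measurable_unit_cube n) mfN mlim
  fNae iT fNt.
split=> //.
have J_int N : (\int[leb n]_(u in cube n) fN N u)%E = (series J N)%:E.
  rewrite /fN; under eq_integral do rewrite seriesEord -sumEFin.
  rewrite integral_sum//.
  - by rewrite seriesEord -sumEFin; apply: eq_bigr => k _; exact: gJ.
  - exact: measurable_unit_cube.
  - by move=> k; apply: (@bounded_integrable_cube _ (g k) (t k)).
have sJ : (EFin \o series J) @ \oo -->
    (fine (\int[leb n]_(u in cube n)
      (limn (series (fun k => g k u)))%:E))%:E.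
  rewrite fineK; last exact: (integrable_fin_num (@measurable_unit_cube n) ilim).
  have := fNint; rewrite (_ : [sequence _]_n = EFin \o series J)//.
  by apply/funext => N; exact: J_int.
by apply/esym/cvg_lim => //; exact: (fine_cvg sJ).
Qed.

End UnitCube.

(** * Limits along the odd primes *)

Section OddPrimes.

Lemma odd_primes_filter : Filter odd_primes.
Proof. exact: within_filter. Qed.

Lemma odd_primes_proper : ProperFilter odd_primes.
Proof.
apply: Build_ProperFilter odd_primes_filter => -[N _ NP].
have [p Np pp] := prime_above (maxn N 2).
apply: (NP p) => /=; first by rewrite (leq_trans (leq_maxl N 2))// ltnW.
rewrite pp; have [p2|//] := even_prime pp.
by move: Np; rewrite p2 gtn_max ltnn andbF.
Qed.

Lemma near_odd_primes (Q : set nat) N :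
  (forall p, (N < p)%N -> prime p -> odd p -> Q p) ->
  \forall p \near odd_primes, Q p.
Proof.
move=> h; rewrite near_withinE; exists N.+1 => // p /= Np /andP[pp po].
exact: h.
Qed.

End OddPrimes.
#[local] Existing Instance odd_primes_proper.

Lemma cvg_sum_seq (R : realType) (T : Type) (F : set_system T) (FF : Filter F)
    (I : Type) (s : seq I) (Q : pred I) (f : I -> T -> R) (l : I -> R) :
  (forall i, Q i -> f i x @[x --> F] --> l i) ->
  \sum_(i <- s | Q i) f i x @[x --> F] --> \sum_(i <- s | Q i) l i.
Proof.
move=> fl; elim: s => [|i s IH].
  by rewrite big_nil; under eq_fun do rewrite big_nil; exact: cvg_cst.
rewrite big_cons; under eq_fun do rewrite big_cons.
by case: ifP => [/fl il|_] //; exact: cvgD.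
Qed.

Lemma ln_prod (R : realType) (I : finType) (F : I -> R) :
  (forall i, 0 < F i) -> ln (\prod_i F i) = \sum_i ln (F i).
Proof.
move=> F0; suff [] : 0 < \prod_i F i /\ ln (\prod_i F i) = \sum_i ln (F i) by [].
apply: (big_ind2 (fun x y => 0 < x /\ ln x = y)); first by rewrite ln1.
  move=> x a y b [x0 <-] [y0 <-]; split; first exact: mulr_gt0.
  by rewrite lnM.
by move=> i _; split.
Qed.

Lemma clog_real (R : realType) (x : R) : 0 < x -> clog x%:C%C = (ln x)%:C%C.
Proof.
move=> x0; rewrite /clog /carg /cabs /= expr0n addr0 sqrtr_sqr gtr0_norm//.
by rewrite lexx divff ?gt_eqF// acos1.
Qed.

Lemma Re_realM (R : realType) (x : R) (z : R[i]) :
  complex.Re (x%:C%C * z) = x * complex.Re z.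
Proof. by case: z => a b /=; rewrite mul0r subr0. Qed.

Lemma Im_realM (R : realType) (x : R) (z : R[i]) :
  complex.Im (x%:C%C * z) = x * complex.Im z.
Proof. by case: z => a b /=; rewrite mul0r addr0. Qed.

Lemma Re_natM (R : realType) n (z : R[i]) :
  complex.Re (n%:R * z) = n%:R * complex.Re z.
Proof. by rewrite -(rmorph_nat (real_complex R)) Re_realM. Qed.

Lemma Im_natM (R : realType) n (z : R[i]) :
  complex.Im (n%:R * z) = n%:R * complex.Im z.
Proof. by rewrite -(rmorph_nat (real_complex R)) Im_realM. Qed.

Lemma norm_real_complex (R : realType) (x : R) : `|x%:C%C| = `|x|%:C%C :> R[i].
Proof. by rewrite normc_def /= expr0n addr0 sqrtr_sqr. Qed.

Lemma cvg_real_complex (R : realType) (T : Type) (F : set_system T)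
    {FF : Filter F} (f : T -> R) (l : R) :
  f @ F --> l -> ((f x)%:C%C : R[i]^o) @[x --> F] --> (l%:C%C : R[i]^o).
Proof.
move=> fl; apply/(@cvgrPdist_le _ R[i]^o) => eps.
rewrite ltcE /= => /andP[/eqP eps0 epsp].
have /cvgrPdist_le/(_ _ epsp) := fl; apply: filterS => x xe.
rewrite -rmorphB /= [X in X <= _]norm_real_complex.
by rewrite lecE /= eps0 eqxx.
Qed.

Lemma cycle_steps (X : finType) (E : rel X) (s : seq X) : s <> [::] ->
  cycle E s = all (fun a => E a.1 a.2) (steps s).
Proof.
case: s => // x t _; rewrite steps_cons /=; move: {1 3}x => y.
by elim: t y => [|z t IH] y /=; rewrite ?andbT// IH.
Qed.

Section Hmat.
Variables (R : realType) (r : nat) (u : #|{: pairs r}|.-tuple R) (p : nat).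

Lemma hmat_skew i j : hmat u p j i = - hmat u p i j.
Proof. by rewrite !mxE opprB. Qed.

Lemma hmat_diag i : hmat u p i i = 0.
Proof. by rewrite !mxE subrr. Qed.

Lemma hmatE (q : pairs r) : hmat u p (val q).1 (val q).2 =
  (Num.floor (p%:R * pair_coord u q))%:~R.
Proof.
rewrite !mxE -surjective_pairing valK insubF ?subr0//=.
by rewrite ltnNge ltnW// (valP q).
Qed.

End Hmat.

Lemma cvg_floor_div (R : realType) (x : R) :
  (Num.floor (p%:R * x))%:~R / p%:R @[p --> odd_primes] --> x.
Proof.
(* The limit is proved along all integers, shifted to [p.+1] so that the divisor is positive. *)
apply: cvg_within_filter; rewrite -(cvg_shiftS _).
apply: (@squeeze_cvgr _ _ _ _ (fun p => x - p.+1%:R^-1) (fun=> x)).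
- apply: nearW => p; have p0 : 0 < p.+1%:R :> R by [].
  have /andP[fl fu] := floor_itv (p.+1%:R * x).
  rewrite ler_pdivrMr// [_ * p.+1%:R]mulrC fl andbT ler_pdivlMr//.
  rewrite mulrBl mulVf ?gt_eqF// lerBlDr mulrC ltW// (lt_le_trans fu)//.
  by rewrite intrD.
- rewrite -{2}[x]subr0; apply: cvgB; first exact: cvg_cst.
  exact: cvg_harmonic.
- exact: cvg_cst.
Qed.

(** * Expansion of F and its Fourier coefficients *)

Section LoopExpansion.
Variables (R : realType) (X : finType) (E : rel X) (r : nat).
Variables (e : 'I_r -> X * X) (C : X -> X -> R) (kappa : X -> R).
Hypothesis e_inj : forall i j, e i = e j -> i = j.
Hypothesis e_opp : forall i j, e i <> opp_edge (e j).
Hypothesis E_conn : connected_graph E.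
Hypothesis E_cond : conductances E C.
Hypothesis kappa_kill : killing kappa.

Local Notation Ptr := (trans C kappa).
Local Notation point := (#|{: pairs r}|.-tuple R).
Local Notation weight s := (\prod_(a <- steps s) Ptr a.1 a.2).
Local Notation mass := (loop_mass C kappa).
Local Notation M u p := (twisted_trans e Ptr (Urep (hmat u p))).

Definition balanced (s : seq X) := [forall i, net_crossings e i (steps s) == 0].

Definition cross (q : pairs r) (s : seq X) : int :=
  pair_crossings e (val q).1 (val q).2 (steps s).

Lemma balanced_rot k s : balanced (rot k s) = balanced s.
Proof. by apply: eq_forallb => i; rewrite steps_rot net_crossings_rot. Qed.

Lemma cross_rot k q s : balanced s -> cross q (rot k s) = cross q s.
Proof.
move=> /forallP s0.
by rewrite /cross steps_rot pair_crossings_rot//; apply/eqP/s0.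
Qed.

Lemma net_crossings_bound i st : (`|net_crossings e i st| <= size st)%N.
Proof.
elim: st => [|a st IH]; first by rewrite /net_crossings big_nil.
rewrite net_crossings_cons /= -add1n.
have : (`|edge_sign e i a| <= 1)%N.
  by rewrite /edge_sign; case: (_ == _); case: (_ == _).
by move: (edge_sign e i a) (net_crossings e i st) IH => x y; lia.
Qed.

Definition floor_phase p (u : point) s : R :=
  \sum_q 2 * pi * (2 * cross q s)%:~R
    * ((Num.floor (p%:R * pair_coord u q))%:~R / p%:R).

Definition loop_phase (u : point) s : R :=
  \sum_q 2 * pi * (2 * cross q s)%:~R * pair_coord u q.

(** Net crossings are bounded by the length, so for loops shorter than p they vanish modulo p
    exactly when they vanish as integers. *)
Lemma holonomy_trace_hmat p (u : point) s : prime p -> odd p ->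
  (size s < p)%N ->
  holonomy_trace R e (hmat u p) (steps s) =
  if balanced s then (p ^ r)%:R * cis (floor_phase p u s) else 0.
Proof.
move=> pp po sp; case: ifPn => [/forallP s0|].
  rewrite (holonomy_trace_eq0 R e_inj e_opp)//; last 3 first.
  - exact: hmat_skew.
  - exact: hmat_diag.
  - by move=> i; exact/eqP.
  congr (_ * _); under eq_bigr do rewrite hmatE -intrM.
  rewrite -[2]/(2%:~R) -rmorph_sum -rmorphM /= root_char_int//; congr cis.
  rewrite mulr_sumr rmorph_sum /= /floor_phase mulr_sumr mulr_suml.
  apply: eq_bigr => q _; rewrite -/(cross q s) !intrM.
  by move: p%:R^-1 => c; ring.
rewrite negb_forall => /existsP[i si]; apply: holonomy_trace_neq0 => //.
apply/eqP => /colP/(_ i); rewrite net_vecE mxE => /eqP.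
rewrite Fp_int_eq0//; first exact/negP.
by apply: leq_ltn_trans sp; rewrite -(size_steps s); exact: net_crossings_bound.
Qed.

Lemma mxtrace_hmat p (u : point) n : prime p -> odd p -> (n.+1 < p)%N ->
  \tr (M u p ^+ n.+1) = (p ^ r)%:R * \sum_(s : n.+1.-tuple X | balanced s)
    (weight s)%:C%C * cis (floor_phase p u s).
Proof.
move=> pp po np; rewrite mxtrace_twisted_trans// mulr_sumr [RHS]big_mkcond /=.
apply: eq_bigr => s _; rewrite holonomy_trace_hmat ?size_tuple//.
by case: ifP; rewrite ?mulr0// mulrCA.
Qed.

(** The term of index n in the expansion of log det (I - M) / p^r; taking the real part loses
    nothing, by [log_det_series]. *)
Definition trace_coef p (u : point) n : R :=
  - complex.Re (\tr (M u p ^+ n.+1)) / (p ^ r)%:R / n.+1%:R.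

Lemma trace_bound p (u : point) n : prime p ->
  `|complex.Re (\tr (M u p ^+ n.+1))| <= (p ^ r)%:R * mass n.
Proof.
move=> pp; rewrite mxtrace_twisted_trans// raddf_sum /=.
rewrite (le_trans (ler_norm_sum _ _ _))// /loop_mass mulr_sumr.
apply: ler_sum => s _.
rewrite Re_realM.
have w0 := steps_weight_ge0 E_conn E_cond kappa_kill s.
by rewrite normrM (ger0_norm w0) mulrC ler_wpM2r// Re_holonomy_trace_le.
Qed.

Lemma trace_coef_bound p (u : point) n : prime p ->
  `|trace_coef p u n| <= mass n.
Proof.
move=> pp; have pr0 : 0 < (p ^ r)%:R :> R by rewrite ltr0n expn_gt0 prime_gt0.
rewrite /trace_coef !mulNr normrN !normrM !normfV !normr_nat.
rewrite (@le_trans _ _ (mass n / n.+1%:R))//.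
  by rewrite ler_wpM2r// ler_pdivrMr// mulrC trace_bound.
by rewrite ler_piMr ?invf_le1 ?ler1n//; exact: loop_mass_ge0 E_conn E_cond _ _.
Qed.

Lemma log_det_series p (u : point) : prime p -> odd p ->
  [/\ forall n, complex.Im (\tr (M u p ^+ n.+1)) = 0,
      log_det e Ptr u p = (complex.Re (log_det e Ptr u p))%:C%C &
      series (trace_coef p u) @ \oo --> complex.Re (log_det e Ptr u p)].
Proof.
move=> pp po.
have pr0 : 0 < (p ^ r)%:R :> R by rewrite ltr0n expn_gt0 prime_gt0.
have [C_sym _ _] := E_cond.
have [d [trE detE]] := twisted_trans_spectrum e_inj e_opp C_sym
  (lambda_gt0 E_conn E_cond kappa_kill) pp (hmat_diag u p).
(* Otherwise every even-power trace, a sum of squares, would be at least 1. The threshold 1 / (2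
   p^r) on [mass] makes [trace_bound] give at most 1/2 for the exponent 2 (N+1). *)
have d1 i : `|d i| < 1.
  rewrite ltNge; apply/negP => di.
  have /cvgr0_norm_le := cvg_series_cvg_0 (cvg_loop_mass E_conn E_cond kappa_kill).
  have pr2 : 0 < ((p ^ r)%:R * 2)^-1 :> R by rewrite invr_gt0 mulr_gt0.
  move=> /(_ _ pr2) [N _ /(_ (N + N).+1) /=].
  rewrite (leq_trans (leq_addr _ _) (leqnSn _)) => /(_ isT).
  have := trace_bound u (N + N).+1 pp; rewrite trE /=.
  have -> : (N + N).+2 = (N.+1 * 2)%N by rewrite muln2 -addnn addSn addnS.
  have sum_ge1 : 1 <= \sum_i d i ^+ (N.+1 * 2).
    rewrite (bigD1 i)//= ler_wpDr//.
      by apply: sumr_ge0 => j _; rewrite exprM sqr_ge0.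
    by rewrite exprM -[leRHS]ger0_norm ?sqr_ge0// !normrX exprn_ege1// exprn_ege1.
  move=> tb mb.
  have : 1 <= (p ^ r)%:R * (((p ^ r)%:R * 2)^-1 : R).
    rewrite (le_trans sum_ge1)// (le_trans (ler_norm _))// (le_trans tb)//.
    rewrite ler_pM2l//; exact: le_trans (ler_norm _) mb.
  by rewrite invfM mulrA divff ?gt_eqF// mul1r leNgt invf_lt1// ltr1n.
have d_gt0 i : 0 < 1 - d i.
  by rewrite subr_gt0 (le_lt_trans (ler_norm _)).
(* The determinant is a product of positive reals, on which the principal logarithm is additive. *)
have logE : log_det e Ptr u p = ((p ^ r)%:R^-1 * \sum_i ln (1 - d i))%:C%C.
  rewrite /log_det detE clog_real ?prodr_gt0// ln_prod// rmorphM /= fmorphV.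
  by rewrite rmorph_nat.
split=> [n||]; first by rewrite trE.
  by rewrite logE.
rewrite logE /= (_ : series _ = fun N => (p ^ r)%:R^-1
    * \sum_i - series (fun n => d i ^+ n.+1 / n.+1%:R) N); last first.
  apply/funext => N; rewrite sumrN /series /= exchange_big /= mulrN mulr_sumr.
  rewrite -sumrN; apply: eq_bigr => n _.
  by rewrite /trace_coef trE /= -mulr_suml !mulNr mulrA [_^-1 * _]mulrC.
apply: cvgMr; apply: cvg_sum_seq => i _.
by rewrite -[ln _]opprK; apply: cvgN; exact: cvg_ln_series.
Qed.

Definition loop_coef (u : point) n : R :=
  - (\sum_(s : n.+1.-tuple X | balanced s) weight s * cos (loop_phase u s))
  / n.+1%:R.

Lemma cvg_floor_phase (u : point) s :
  floor_phase p u s @[p --> odd_primes] --> loop_phase u s.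
Proof.
apply: cvg_sum_seq => q _; apply: cvgMr; exact: cvg_floor_div.
Qed.

(** For fixed n the trace reduces to balanced loops as soon as p exceeds n+1; what remains is a
    finite sum with converging phases. *)
Lemma cvg_trace_coef (u : point) n :
  trace_coef p u n @[p --> odd_primes] --> loop_coef u n.
Proof.
apply: (@cvg_trans _ ((- (\sum_(s : n.+1.-tuple X | balanced s)
    weight s * cos (floor_phase p u s)) / n.+1%:R) @[p --> odd_primes])).
  apply: near_eq_cvg; apply: (@near_odd_primes _ n.+1) => p np pp po.
  have pr0 : (p ^ r)%:R != 0 :> R by rewrite pnatr_eq0 -lt0n expn_gt0 prime_gt0.
  apply/esym; rewrite /trace_coef mxtrace_hmat//.
  rewrite !mulNr; congr (- (_ / _)).
  rewrite Re_natM mulrAC divff// mul1r raddf_sum /=.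
  by apply: eq_bigr => s _; rewrite mul0r subr0.
apply: cvgMl; apply: cvgN; apply: cvg_sum_seq => s _; apply: cvgMr.
apply: (@continuous_cvg _ _ _ odd_primes _ _ (@cos R)); first exact: continuous_cos.
exact: cvg_floor_phase.
Qed.

(* The twisted trace is real, hence so is its limit. *)
Lemma sum_sin_loop_phase (u : point) n :
  \sum_(s : n.+1.-tuple X | balanced s) weight s * sin (loop_phase u s) = 0.
Proof.
have : \sum_(s : n.+1.-tuple X | balanced s) weight s * sin (floor_phase p u s)
    @[p --> odd_primes] --> \sum_(s : n.+1.-tuple X | balanced s)
    weight s * sin (loop_phase u s).
  apply: cvg_sum_seq => s _; apply: cvgMr.
  apply: (@continuous_cvg _ _ _ odd_primes _ _ (@sin R)).
    exact: continuous_sin.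
  exact: cvg_floor_phase.
move=> /cvg_lim <-//; apply: cvg_lim => //; apply: cvg_near_cst.
apply: (@near_odd_primes _ n.+1) => p np pp po.
have [/(_ n) + _ _] := log_det_series u pp po; rewrite mxtrace_hmat//.
rewrite Im_natM => /eqP.
rewrite mulf_eq0 pnatr_eq0 expn_eq0 (gtn_eqF (prime_gt0 pp)) /= => /eqP.
rewrite raddf_sum /= => z0; rewrite -[RHS]z0; apply: eq_bigr => s _.
by rewrite mul0r addr0.
Qed.

(** The bound on [loop_coef] is recorded because the convergence of its series is needed again when
    it is multiplied by a Fourier mode. *)
Lemma cvg_log_det (u : point) :
  (forall n, `|loop_coef u n| <= mass n) /\
  ((log_det e Ptr u p : R[i]^o) @[p --> odd_primes] -->
   ((limn (series (loop_coef u)))%:C%C : R[i]^o)).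
Proof.
have [lb lim] := @tannery R odd_primes _ (fun p => trace_coef p u)
  (loop_coef u) mass (fun p => complex.Re (log_det e Ptr u p))
  (@near_odd_primes _ 0 (fun p _ pp _ n => trace_coef_bound u n pp))
  (@near_odd_primes _ 0 (fun p _ pp po =>
     let: And3 _ _ h := log_det_series u pp po in h))
  (cvg_loop_mass E_conn E_cond kappa_kill) (@cvg_trace_coef u).
split=> //.
have logE : \forall p \near odd_primes,
    (complex.Re (log_det e Ptr u p))%:C%C = log_det e Ptr u p :> R[i]^o.
  apply: (@near_odd_primes _ 0) => p _ pp po.
  by have [_ /esym] := log_det_series u pp po.
exact: cvg_trans (near_eq_cvg logE) (cvg_real_complex lim).
Qed.

Lemma FlimE (u : point) :
  Flim e Ptr u = (limn (series (loop_coef u)))%:C%C.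
Proof.
apply: (@cvg_lim R[i]^o); first exact: norm_hausdorff.
by have [] := cvg_log_det u.
Qed.

Definition in_class (m : {ffun pairs r -> int}) (s : seq X) :=
  balanced s && [forall q, cross q s == m q].

Lemma in_class_rot m k s : in_class m (rot k s) = in_class m s.
Proof.
rewrite /in_class balanced_rot; have [sb|//] := boolP (balanced s).
by apply: eq_forallb => q; rewrite cross_rot.
Qed.

(** The part of the loop measure of the class carried by loops of length n+1, in the form given by
    [esum_loops]. *)
Definition class_mass m n : R :=
  (\sum_(s : n.+1.-tuple X | in_class m s) weight s) / n.+1%:R.

Lemma weight_ge0 (s : seq X) : 0 <= weight s.
Proof. exact: steps_weight_ge0 E_conn E_cond kappa_kill s. Qed.

Lemma sum_weight_le (Q : pred (seq X)) (f : seq X -> R) n :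
  (forall s, `|f s| <= 1) ->
  `|- (\sum_(s : n.+1.-tuple X | Q s) weight s * f s) / n.+1%:R| <= mass n.
Proof.
move=> f1; rewrite mulNr normrN normrM normfV normr_nat.
rewrite (@le_trans _ _ (mass n / n.+1%:R))//.
  rewrite ler_wpM2r// (le_trans (ler_norm_sum _ _ _))// big_mkcond /=.
  apply: ler_sum => s _; case: ifP => _; last exact: weight_ge0.
  by rewrite normrM (ger0_norm (weight_ge0 s)) ler_piMr// weight_ge0.
by rewrite ler_piMr ?invf_le1 ?ler1n//; exact: loop_mass_ge0 E_conn E_cond _ _.
Qed.

Lemma cvg_class_mass m : cvgn (series (class_mass m)).
Proof.
apply: (dominated_series_cvg _ (cvg_loop_mass E_conn E_cond kappa_kill)) => n.
have := @sum_weight_le (in_class m) (fun=> 1) n.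
rewrite mulNr normrN /class_mass; under eq_bigr do rewrite mulr1.
by apply => s; rewrite normr1.
Qed.

Lemma loop_measure_class m :
  loop_measure C kappa [set l : loop E | in_class m (based_at l)] =
  (limn (series (class_mass m)))%:E.
Proof.
rewrite /loop_measure /loop_weight.
rewrite (@esum_loops R X E (fun s => weight s)) ?(@in_class_rot m)//.
- rewrite -EFin_lim; last exact: cvg_class_mass.
  by congr (limn _); apply/funext => N; rewrite /= -sumEFin.
- exact: weight_ge0.
- by move=> k s; rewrite steps_rot (perm_big _ (permEl (perm_rot _ _))).
- move=> s s0; rewrite cycle_steps// => /allPn[a ast aE].
  have [_ _ C0] := E_cond; rewrite (big_rem a)//= /trans C0//.
  by rewrite mul0r mul0r.
- by move=> k s; exact: in_class_rot.
Qed.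

Definition mode_phase (m : {ffun pairs r -> int}) (u : point) : R :=
  \sum_q 2 * pi * (2 * m q)%:~R * pair_coord u q.

(** One family for both parts of a term of F times the conjugate mode: the shift c = 0 gives the
    real part, c = - pi / 2 turns the cosine into the sine of the imaginary part. *)
Definition mode_coef m (c : R) n (u : point) : R :=
  - (\sum_(s : n.+1.-tuple X | balanced s)
      weight s * cos (c + (loop_phase u s - mode_phase m u))) / n.+1%:R.

(** In the expanded cosine of the difference of phases, the terms with the sine of [loop_phase] sum
    to 0, so multiplying by the mode merely shifts the phases. *)
Lemma loop_coef_cos m n u :
  loop_coef u n * cos (mode_phase m u) = mode_coef m 0 n u.
Proof.
rewrite /loop_coef /mode_coef mulrAC mulNr; congr (- _ / _).
under [RHS]eq_bigr do rewrite add0r cosD cosN sinN mulrN opprK mulrDr !mulrA.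
by rewrite big_split /= -!mulr_suml sum_sin_loop_phase mul0r addr0.
Qed.

Lemma loop_coef_sin m n u :
  loop_coef u n * - sin (mode_phase m u) = mode_coef m (- (pi / 2)) n u.
Proof.
rewrite /loop_coef /mode_coef mulrAC mulNr; congr (- _ / _).
under [RHS]eq_bigr do rewrite addrC cosBpihalf sinD cosN sinN mulrDr !mulrA.
by rewrite big_split /= -!mulr_suml sum_sin_loop_phase mul0r add0r.
Qed.

Definition mode_freq m (s : seq X) (k : 'I_#|{: pairs r}|) : int :=
  2 * cross (enum_val k) s - 2 * m (enum_val k).

Lemma mode_phaseB m s u : loop_phase u s - mode_phase m u =
  \sum_k 2 * pi * (mode_freq m s k)%:~R * tnth u k.
Proof.
rewrite [RHS](reindex (@enum_rank _)); last exact/onW_bij/enum_rank_bij.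
rewrite -sumrB; apply: eq_bigr => q _; rewrite /mode_freq enum_rankK.
by rewrite -mulrBl -mulrBr -rmorphB.
Qed.

Lemma mode_freq_eq0 m s :
  [forall k, mode_freq m s k == 0] = [forall q, cross q s == m q].
Proof.
have eq0 (a b : int) : (2 * a - 2 * b == 0) = (a == b) by lia.
apply/forallP/forallP => [h q|h k]; last by rewrite /mode_freq eq0.
by have := h (enum_rank q); rewrite /mode_freq enum_rankK eq0.
Qed.

Lemma measurable_mode_coef m c n :
  measurable_fun [set: point] (mode_coef m c n).
Proof.
have mf (s : n.+1.-tuple X) : measurable_fun [set: point]
    (fun u => weight s * cos (c + (loop_phase u s - mode_phase m u))).
  apply: measurable_funM => //; under eq_fun do rewrite mode_phaseB.
  exact: measurable_cos_phase.
pose fs := [seq s : n.+1.-tuple X <- index_enum _ | balanced s].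
have mS := measurable_sum fs mf.
rewrite (_ : mode_coef m c n = fun u => - (\sum_(s <- fs)
    weight s * cos (c + (loop_phase u s - mode_phase m u))) * n.+1%:R^-1).
  by apply: measurable_funM => //; exact: measurableT_comp.
by apply/funext => u; rewrite big_filter.
Qed.

Lemma mode_coef_le m c n u : `|mode_coef m c n u| <= mass n.
Proof.
apply: (@sum_weight_le balanced (fun s =>
  cos (c + (loop_phase u s - mode_phase m u)))) => s.
exact: cos_max.
Qed.

(** Integration keeps the balanced loops whose frequencies match those of the mode, which are the
    loops of the class [m]; the shift survives only as the factor [cos c]. *)
Lemma integral_mode_coef m c n :
  (\int[lebesgue_tuple R #|{: pairs r}|]_(u in unit_cube R #|{: pairs r}|)
     (mode_coef m c n u)%:E = (- (cos c * class_mass m n))%:E)%E.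
Proof.
pose f (s : n.+1.-tuple X) (u : point) :=
  cos (c + \sum_k 2 * pi * (mode_freq m s k)%:~R * tnth u k).
have fi s : (lebesgue_tuple R #|{: pairs r}|).-integrable
    (unit_cube R #|{: pairs r}|) (EFin \o f s).
  apply: (bounded_integrable_cube (B := 1)); first exact: measurable_cos_phase.
  by move=> u; exact: cos_max.
have mcube := @measurable_unit_cube R #|{: pairs r}|.
transitivity (\int[lebesgue_tuple R #|{: pairs r}|]_(u in unit_cube R #|{: pairs r}|)
    \sum_(s : n.+1.-tuple X | balanced s)
      ((- weight s / n.+1%:R)%:E * (f s u)%:E))%E.
  apply: eq_integral => u _; rewrite sumEFin; congr (_%:E).
  rewrite /mode_coef -sumrN mulr_suml; apply: eq_bigr => s _.
  by rewrite /f -mode_phaseB !mulNr mulrAC.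
rewrite integral_sum//; last first.
  by move=> s; apply: integrableZl => //; exact: fi.
under eq_bigr => s _.
  rewrite integralZl//; last exact: fi.
  rewrite integral_cube_cos mode_freq_eq0 -EFinM.
  over.
rewrite sumEFin /class_mass /in_class [in RHS]big_mkcondr /=; congr (_%:E).
rewrite mulrA mulr_sumr mulr_suml -sumrN; apply: eq_bigr => s _.
by case: ifP => _; [ring|rewrite !(mulr0, mul0r) oppr0].
Qed.

(** To be used twice: [a] is the real or the imaginary part of e^(-i [mode_phase]), and [c] the
    corresponding shift. *)
Lemma mode_integral m (G : point -> R) c (a : point -> R) :
  (forall u n, loop_coef u n * a u = mode_coef m c n u) ->
  (forall u, G u = limn (series (loop_coef u)) * a u) ->
  (lebesgue_tuple R #|{: pairs r}|).-integrable
    (unit_cube R #|{: pairs r}|) (EFin \o G) /\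
  \int[lebesgue_tuple R #|{: pairs r}|]_(u in unit_cube R #|{: pairs r}|) G u
  = - (cos c * limn (series (class_mass m))).
Proof.
move=> aE GE; have ct := cvg_loop_mass E_conn E_cond kappa_kill.
have -> : G = fun u => limn (series (fun n => mode_coef m c n u)).
  apply/funext => u; rewrite GE; apply/esym/cvg_lim => //.
  rewrite (_ : series _ = fun N => series (loop_coef u) N * a u).
    apply: cvgMl; have [lb _] := cvg_log_det u.
    exact: dominated_series_cvg lb ct.
  apply/funext => N; rewrite /series /= mulr_suml.
  by apply: eq_bigr => n _; rewrite -aE.
have [gi ->] := integral_cube_series (measurable_mode_coef m c)
  (mode_coef_le m c) ct (integral_mode_coef m c).
split=> //; apply: cvg_lim => //.
rewrite (_ : series _ = fun N => - (cos c * series (class_mass m) N)).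
  by apply: cvgN; apply: cvgMr; exact: cvg_class_mass.
by apply/funext => N; rewrite /series /= mulr_sumr -sumrN.
Qed.

End LoopExpansion.

(* The Fourier mode attached to m has frequencies 2 m_ij, see the comment on
   Urep_commutation. *)
Theorem theorem4 (R : realType) (X : finType) (E T : rel X) (r : nat)
    (e : 'I_r -> X * X) (C : X -> X -> R) (kappa : X -> R)
    (d : measure_display) (Omega : measurableType d) (P : probability Omega R)
    (alpha : R) (L : Omega -> loop E -> nat)
    (HE : simple_graph E) (HEc : connected_graph E)
    (Hr : (r + #|X| = #|edge_set E| + 1)%N)
    (HT : spanning_tree E T) (He : cotree_orientation E T e)
    (HC : conductances E C) (Hk : killing kappa)
    (Ha : 0 < alpha)
    (HL : poisson_point_process P
            (fun A => (alpha%:E * loop_measure C kappa A)%E) L) :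
  let mu := @loop_measure R X C kappa E in
  let has_crossings := fun m : {ffun pairs r -> int} =>
    [set l : loop E | forall q : pairs r,
       Ncheck e (val q).1 (val q).2 l = m q] in
  let count := fun m : {ffun pairs r -> int} =>
    num_points R L ([set l | (1 < degree R e l)%E] `&` has_crossings m) in
  let event := fun m : {ffun pairs r -> int} =>
    [set l : loop E | h1 e l = 0] `&` has_crossings m in
  let n := #|{: pairs r}| in
  let F := @Flim R r X e (trans C kappa) in
  [/\ independent_family P count,
      forall m, poisson_variable P (count m) (alpha%:E * mu (event m))%E,
      forall u : n.-tuple R, (forall k, 0 <= tnth u k < 1) ->
        cvg ((log_det e (trans C kappa) u p : R[i]^o) @[p --> odd_primes]) &
      forall m : {ffun pairs r -> int},
        let integrand := fun u : n.-tuple R =>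
          F u * \prod_(q : pairs r)
                  cis (- (2 * pi * (2 * m q)%:~R * pair_coord u q)) in
        [/\ (mu (event m) < +oo)%E,
            cintegrable (lebesgue_tuple R n) (unit_cube R n) integrand &
            (alpha * fine (mu (event m)))%:C%C
            = - alpha%:C%C
              * cintegral (lebesgue_tuple R n) (unit_cube R n) integrand]].
Proof.
move=> mu has_crossings count event n F.
have [_ e_inj e_opp _] := He; have [HL1 HL2] := HL.
have eventE m : event m = [set l : loop E | in_class e m (based_at l)].
  apply/seteqP; split=> l /=.
    move=> [/=]; rewrite h1E// => /rowP l0 lm; apply/andP; split.
      by apply/forallP => i; have := l0 i; rewrite !mxE => ->.
    by apply/forallP => q; rewrite /cross -signed_crossingsE; apply/eqP/lm.
  move=> /andP[/forallP l0 /forallP lm]; split=> [|q] /=.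
    by rewrite h1E//; apply/rowP => i; rewrite !mxE; apply/eqP/l0.
  by rewrite /Ncheck signed_crossingsE; apply/eqP/lm.
have countE m : count m = num_points R L (event m).
  rewrite /count; congr (num_points R L (_ `&` _)).
  by apply/seteqP; split=> l /= /degree_gt1.
split.
- move=> s us B mB.
  (* The point process provides independence for disjoint families indexed by an ordinal, so the
     list [s] is indexed by its positions; it has no repetition, and distinct modes give disjoint
     events. *)
  pose A (i : 'I_(size s)) := event (tnth (in_tuple s) i).
  have s_inj : injective (tnth (in_tuple s)) by exact/tuple_uniqP.
  have tA : trivIset setT A.
    apply/trivIsetP => i j _ _ ij; apply/seteqP; split=> // l [[_ li] [_ lj]].
    move: ij => /negP; apply; apply/eqP; apply: s_inj.
    by apply/ffunP => q; rewrite -li -lj.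
  have := HL2 _ A tA (enum 'I_(size s)) (enum_uniq _)
    (fun i => B (tnth (in_tuple s) i)) (fun i => mB _).
  rewrite big_enum /= => prodE.
  transitivity (P (\bigcap_(i in [set` enum 'I_(size s)])
      (num_points R L (A i) @^-1` B (tnth (in_tuple s) i)))).
    congr (P _); apply/seteqP; split=> w /= h.
      by move=> i _ /=; rewrite -countE; apply: h => /=; exact: mem_tnth.
    move=> m ms; have /tnthP[i ->] : m \in in_tuple s by [].
    by rewrite countE; apply: h; rewrite /= mem_enum.
  rewrite prodE [in RHS](big_tnth _ _ s) /=.
  by apply: eq_bigr => i _; rewrite countE.
- by move=> m; rewrite countE; exact: HL1.
- move=> u _; apply/cvg_ex.
  by have [_ lim] := cvg_log_det e_inj e_opp HEc HC Hk u; eexists; exact: lim.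
move=> m integrand; have muE := loop_measure_class e HEc HC Hk m.
have cisE u : \prod_(q : pairs r)
    cis (- (2 * pi * (2 * m q)%:~R * pair_coord u q)) =
    cis (- mode_phase m u) :> R[i].
  rewrite /mode_phase -sumrN.
  by rewrite (big_morph _ (@cisD R) (cis0 R)).
have reG u : complex.Re (integrand u) =
    limn (series (loop_coef e C kappa u)) * cos (mode_phase m u).
  by rewrite /integrand cisE /F (FlimE e_inj e_opp HEc HC Hk) Re_realM /= cosN.
have imG u : complex.Im (integrand u) =
    limn (series (loop_coef e C kappa u)) * - sin (mode_phase m u).
  by rewrite /integrand cisE /F (FlimE e_inj e_opp HEc HC Hk) Im_realM /= sinN.
have [reI reE] := mode_integral e_inj e_opp HEc HC Hk
  (fun u k => loop_coef_cos e_inj e_opp HEc HC Hk m k u) reG.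
have [imI imE] := mode_integral e_inj e_opp HEc HC Hk
  (fun u k => loop_coef_sin e_inj e_opp HEc HC Hk m k u) imG.
split; rewrite ?eventE /mu ?muE; [exact: ltry|by split|].
(* The shift 0 yields minus the mass of the class; the shift - pi / 2 yields the factor cos (pi / 2)
   = 0, so the imaginary part vanishes. *)
rewrite /cintegral reE imE cos0 cosN cos_pihalf mul1r mul0r oppr0.
apply/eqP; rewrite eq_complex /= !(oppr0, mulr0, mul0r, subr0, addr0).
by rewrite mulrNN !eqxx.
Qed.
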